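(* FDMC is fixed-parameter tractable with respect to $k+r$.
   Context: An instance of \textsc{Fair Discrete Means Cluster Editing} (FDMC) consists of an $m\times n$ matrix $M$ (over some finite domain), a vector $\gamma\in[c]^m$ (the color of row $i$ is $\gamma[i]$), and positive integers $k$ and $r$. A cluster of a matrix is a maximal set of pairwise identical rows. For a color $i\in[c]$ let $|\gamma|_i$ be the number of entries of $\gamma$ equal to $i$. A matrix $M'$ with $m$ rows is fair (w.r.t. $\gamma$) if every cluster $S$ of $M'$ contains exactly $\frac{|\gamma|_i}{m}|S|$ rows of color $i$, for every $i\in[c]$. The task is to decide whether there exists (and find) a fair $m\times n$ matrix $M'$ that differs from $M$ in at most $k$ entries and has at most $r$ distinct rows. *)

(* Defs.v *)
From Stdlib Require Import BinNat.
From mathcomp Require Import all_boot all_order all_algebra.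

Set Implicit Arguments.
Unset Strict Implicit.
Unset Printing Implicit Defensive.

(* Model of computation: a first-order call-by-value functional language over
   binary trees.  Every evaluation rule costs one unit.  As trees are built
   only by pairing existing values, they can be shared, so one unit is a
   constant number of pointer operations (for a fixed program) and the cost is
   polynomially related to the running time of a Turing machine or a RAM. *)
Inductive tree : Type := Leaf | Node of tree & tree.

Fixpoint tree_size (t : tree) : nat :=
  if t is Node a b then (tree_size a + tree_size b).+1 else 1.

(* [Var i] is the de Bruijn index [i].  [Case e e1 e2] continues with [e1] if
   [e] is a leaf, and otherwise with [e2], where [Var 0] and [Var 1] are then
   the left and right subtrees.  [Call f e] calls the [f]-th function of the
   program; in its body [Var 0] is the argument. *)
Inductive expr : Type :=
| Var of nat
| Nil
| Cons of expr & expr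
| Let of expr & expr
| Case of expr & expr & expr
| Call of nat & expr.

Definition program := seq expr.

(* Functions and variables that are not defined denote the leaf; divergence is
   the absence of a derivation. *)
Inductive eval (P : program) : seq tree -> expr -> tree -> nat -> Prop :=
| EvalVar env i : eval P env (Var i) (nth Leaf env i) 1
| EvalNil env : eval P env Nil Leaf 1
| EvalCons env e1 e2 v1 v2 t1 t2 :
    eval P env e1 v1 t1 -> eval P env e2 v2 t2 ->
    eval P env (Cons e1 e2) (Node v1 v2) (t1 + t2).+1
| EvalLet env e1 e2 v1 v2 t1 t2 :
    eval P env e1 v1 t1 -> eval P (v1 :: env) e2 v2 t2 ->
    eval P env (Let e1 e2) v2 (t1 + t2).+1
| EvalCaseLeaf env e e1 e2 v t1 t2 :
    eval P env e Leaf t1 -> eval P env e1 v t2 ->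
    eval P env (Case e e1 e2) v (t1 + t2).+1
| EvalCaseNode env e e1 e2 a b v t1 t2 :
    eval P env e (Node a b) t1 -> eval P [:: a, b & env] e2 v t2 ->
    eval P env (Case e e1 e2) v (t1 + t2).+1
| EvalCall env f e v w t1 t2 :
    eval P env e v t1 -> eval P [:: v] (nth Nil P f) w t2 ->
    eval P env (Call f e) w (t1 + t2).+1.

Definition runs (P : program) (input output : tree) (t : nat) : Prop :=
  eval P [:: input] (Call 0 (Var 0)) output t.

Definition enc_bool (b : bool) : tree := if b then Node Leaf Leaf else Leaf.

Definition enc_seq (T : Type) (enc : T -> tree) (s : seq T) : tree :=
  foldr (fun x t => Node (enc x) t) Leaf s.

Definition enc_option (T : Type) (enc : T -> tree) (o : option T) : tree :=
  if o is Some x then Node (enc x) Leaf else Leaf.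

(* Numbers are written in binary, least significant bit first. *)
Fixpoint enc_pos (p : positive) : tree :=
  match p with
  | xH => Node (enc_bool true) Leaf
  | xO q => Node (enc_bool false) (enc_pos q)
  | xI q => Node (enc_bool true) (enc_pos q)
  end.

Definition enc_nat (n : nat) : tree :=
  if N.of_nat n is Npos p then enc_pos p else Leaf.

Definition enc_ffun (m c : nat) (g : {ffun 'I_m -> 'I_c}) : tree :=
  enc_seq (fun i => enc_nat (g i)) (enum 'I_m).

Definition enc_mx (d m n : nat) (A : 'M['I_d]_(m, n)) : tree :=
  enc_seq (fun i => enc_seq (fun j => enc_nat (A i j)) (enum 'I_n))
          (enum 'I_m).

Definition computable (f : nat -> nat) : Prop :=
  exists P : program, forall n, exists t, runs P (enc_nat n) (enc_nat (f n)) t.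

(* A parameterized problem whose task is to find a solution of the given
   instance, or to report correctly that there is none. *)
Record param_problem : Type := ParamProblem {
  instance : Type;
  enc_instance : instance -> tree;
  parameter : instance -> nat;
  candidate : instance -> Type;
  enc_candidate : forall x : instance, candidate x -> tree;
  is_solution : forall x : instance, candidate x -> Prop
}.

Definition fixed_parameter_tractable (Q : param_problem) : Prop :=
  exists (P : program) (f : nat -> nat) (a : nat),
    computable f /\
    forall x : instance Q, exists (out : option (candidate x)) (t : nat),
      [/\ runs P (enc_instance x) (enc_option (@enc_candidate Q x) out) t,
          t <= f (parameter x) * tree_size (enc_instance x) ^ a
        & match out with
          | Some y => is_solution y
          | None => forall y : candidate x, ~ is_solution y
          end].

(* The finite domain and the set of colors are the ordinals below [domsize]
   and below [ncolors]; both sizes belong to the instance. *)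
Record fdmc_instance : Type := FDMCInstance {
  nrows : nat;
  ncols : nat;
  domsize : nat;
  ncolors : nat;
  mat : 'M['I_domsize]_(nrows, ncols);
  coloring : {ffun 'I_nrows -> 'I_ncolors};
  max_edits : nat;
  max_rows : nat;
  max_edits_gt0 : 0 < max_edits;
  max_rows_gt0 : 0 < max_rows
}.

Definition enc_fdmc_instance (x : fdmc_instance) : tree :=
  enc_seq id [:: enc_nat (nrows x); enc_nat (ncols x); enc_nat (domsize x);
                 enc_nat (ncolors x); enc_mx (mat x); enc_ffun (coloring x);
                 enc_nat (max_edits x); enc_nat (max_rows x)].

Definition identical_rows (d m n : nat) (A : 'M['I_d]_(m, n))
    (S : {set 'I_m}) : bool :=
  [forall i in S, forall j in S, row i A == row j A].

Definition cluster (d m n : nat) (A : 'M['I_d]_(m, n)) (S : {set 'I_m}) : bool :=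
  maxset (identical_rows A) S.

Definition color_class (m c : nat) (g : {ffun 'I_m -> 'I_c}) (i : 'I_c) :
    {set 'I_m} :=
  [set j | g j == i].

Definition fair (d m n c : nat) (g : {ffun 'I_m -> 'I_c})
    (A : 'M['I_d]_(m, n)) : Prop :=
  forall (S : {set 'I_m}) (i : 'I_c), cluster A S ->
    (#|S :&: color_class g i|%:R = #|color_class g i|%:R / m%:R * #|S|%:R
      :> rat)%R.

Definition num_edits (d m n : nat) (A B : 'M['I_d]_(m, n)) : nat :=
  #|[set p : 'I_m * 'I_n | A p.1 p.2 != B p.1 p.2]|.

Definition num_distinct_rows (d m n : nat) (A : 'M['I_d]_(m, n)) : nat :=
  #|[set row i A | i : 'I_m]|.

Definition fdmc_solution (x : fdmc_instance)
    (A : 'M['I_(domsize x)]_(nrows x, ncols x)) : Prop :=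
  [/\ fair (coloring x) A,
      num_edits (mat x) A <= max_edits x
    & num_distinct_rows A <= max_rows x].

Definition FDMC (param : fdmc_instance -> nat) : param_problem :=
  @ParamProblem fdmc_instance enc_fdmc_instance param
    (fun x => 'M['I_(domsize x)]_(nrows x, ncols x))
    (fun x => @enc_mx (domsize x) (nrows x) (ncols x))
    fdmc_solution.

(* Main.v *)
(** If a solution with at most [k] edits and [r] distinct rows exists, the input
    has at most [k + r] distinct rows and at most [k] colors occur on edited
    rows.  Let [c0] be a color without edited rows, if any.  In a fair matrix the
    distribution of every color over the distinct rows is proportional to that of
    [c0]; hence the edits of a color whose input distribution is already
    proportional to that of [c0] permute its rows and can be undone, and all the
    other colors are among the at most [k] edited ones.  Moreover every new cell
    value can be assumed to occur, in the same column, in an input row that ends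
    up in the same cluster and differs from the edited row in at most [k] places.  A solution is
    thus determined, up to exchanging identical rows of one color, by bounded
    advice: the index of [c0], and for each edited row its index among the
    distinct candidate rows together with the cells to be copied from other
    distinct rows.  Checking an advice takes polynomial time, and all advices,
    encoded as trees of bounded height, are tried.

    Polynomial time is obtained from a class of tree functions closed under
    composition and under folds whose accumulator grows additively. *)

From HB Require Import structures.
From Stdlib Require Import BinNat PArith Nnat.
From mathcomp Require Import all_boot all_order all_algebra.
From mathcomp Require Import zify.
Require Import Defs.

Set Implicit Arguments.
Unset Strict Implicit.
Unset Printing Implicit Defensive.

(** * Trees, programs and bounds *)

(** Rows, columns and domain values are all unbounded in number, so an advice cannot name any of
    them. It holds only indices into lists that are recomputed from the input and whose length the
    parameter bounds, and bits consumed at columns where two rows differ. Such columns are few: two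
    different rows with the same final row both pay for their distance to it, so the triangle
    inequality bounds their mutual distance by [k]. Replacing cell values acts as one map on whole
    new rows. It may merge clusters, but the cross-multiplied fairness condition is additive in the
    counts and survives. Two growth classes are needed because the budgets are written in binary:
    even their unary form need not be polynomial in the input. All exponential work is therefore
    done on the budgets alone, with elementary bounds. Since values are shared, a short run can
    build a tree of exponential size. Output sizes are therefore bounded together with running
    times. *)

Fixpoint tree_eqb (t u : tree) : bool :=
  match t, u with
  | Leaf, Leaf => true
  | Node a b, Node c d => tree_eqb a c && tree_eqb b d
  | _, _ => false
  end.

Lemma tree_eqbP : Equality.axiom tree_eqb.
Proof.
elim=> [|a IHa b IHb] [|c d] /=; try by constructor.
by apply: (iffP andP) => [[/IHa-> /IHb->]|[/IHa ? /IHb ?]].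
Qed.

HB.instance Definition _ := hasDecEq.Build tree tree_eqbP.

Definition tfst (t : tree) : tree := if t is Node a _ then a else Leaf.
Definition tsnd (t : tree) : tree := if t is Node _ b then b else Leaf.

Definition lst (s : seq tree) : tree := foldr Node Leaf s.
Fixpoint spine (t : tree) : seq tree := if t is Node a b then a :: spine b else [::].
Definition unary (n : nat) : tree := lst (nseq n Leaf).

Lemma lstK : cancel lst spine.
Proof. by elim=> //= x s ->. Qed.

Lemma spineK : cancel spine lst.
Proof. by elim=> //= a _ b ->. Qed.

Lemma enc_seqE (T : Type) (enc : T -> tree) (s : seq T) : enc_seq enc s = lst (map enc s).
Proof. by rewrite /enc_seq /lst foldr_map. Qed.

Lemma tree_size_gt0 (t : tree) : 0 < tree_size t.
Proof. by case: t. Qed.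

Lemma tree_size_fst t : tree_size (tfst t) <= tree_size t.
Proof. case: t => //= a b; lia. Qed.

Lemma tree_size_snd t : tree_size (tsnd t) <= tree_size t.
Proof. case: t => //= a b; lia. Qed.

Lemma tree_size_cat s1 s2 :
  (tree_size (lst (s1 ++ s2))).+1 = tree_size (lst s1) + tree_size (lst s2).
Proof. elim: s1 => //= x s; lia. Qed.

Lemma tree_size_rcons s x : tree_size (lst (rcons s x)) = tree_size (lst s) + (tree_size x).+1.
Proof. rewrite -cats1; have /= := tree_size_cat s [:: x]; lia. Qed.

Lemma tree_size_rev s : tree_size (lst (rev s)) = tree_size (lst s).
Proof. by elim: s => //= x s IH; rewrite rev_cons tree_size_rcons IH; lia. Qed.

Lemma size_lst s : size s <= tree_size (lst s).
Proof. elim: s => //= x s; lia. Qed.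

Lemma size_spine_unary n : size (spine (unary n)) = n.
Proof. by rewrite lstK size_nseq. Qed.

(* The program [P] of size [n] is embedded at offset [off].  A call outside [P]
   returns the leaf, which [Let _ Nil] does at the same cost. *)
Fixpoint reloc (n off : nat) (e : expr) : expr :=
  match e with
  | Var i => Var i
  | Nil => Nil
  | Cons a b => Cons (reloc n off a) (reloc n off b)
  | Let a b => Let (reloc n off a) (reloc n off b)
  | Case a b c => Case (reloc n off a) (reloc n off b) (reloc n off c)
  | Call f a => if f < n then Call (f + off) (reloc n off a) else Let (reloc n off a) Nil
  end.

Lemma reloc_eval (P Q : program) off env e v t :
  (forall f, f < size P -> nth Nil Q (f + off) = reloc (size P) off (nth Nil P f)) ->
  eval P env e v t -> eval Q env (reloc (size P) off e) v t.
Proof.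
move=> PQ; elim => /=; try by [move=> *; econstructor; eauto].
move=> {}env f {}e {}v w t1 t2 _ IH1 e2 IH2; case: ifP => lt_f.
  by econstructor; [exact: IH1 | rewrite PQ].
econstructor; first exact: IH1.
by move: e2; rewrite nth_default 1?leqNgt ?lt_f // => e2; inversion e2; constructor.
Qed.

Definition computes (P : program) (f : tree -> tree) (T : tree -> nat) : Prop :=
  0 < size P /\
  forall v, exists2 t, eval P [:: v] (nth Nil P 0) (f v) t & t <= T v.

(** The environment is arbitrary because a function body sees only its argument; the successor pays
    for the rule [EvalCall]. *)
Definition callable (Q : program) (k : nat) (f : tree -> tree) (T : tree -> nat) : Prop :=
  forall env e v t, eval Q env e v t ->
    exists2 t', eval Q env (Call k e) (f v) t' & t' <= (t + T v).+1.

Lemma computes_callable P Q off f T :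
  (forall i, i < size P -> nth Nil Q (i + off) = reloc (size P) off (nth Nil P i)) ->
  computes P f T -> callable Q off f T.
Proof.
move=> PQ [P0 cP] env e v t ev; have [t2 ev2 le2] := cP v.
exists (t + t2).+1; last by rewrite ltnS leq_add2l.
by econstructor; [exact: ev | rewrite -[off]add0n PQ //; apply: reloc_eval ev2].
Qed.

(** The indices are fixed before [e] is chosen, so the main expression can mention them. Placing it
    at index 0 also lets it call itself, as the fold does. *)
Lemma link3 P1 P2 P3 f1 f2 f3 T1 T2 T3 :
  computes P1 f1 T1 -> computes P2 f2 T2 -> computes P3 f3 T3 ->
  exists k1 k2 k3, forall e, exists Q : program,
    [/\ 0 < size Q, nth Nil Q 0 = e, callable Q k1 f1 T1, callable Q k2 f2 T2
      & callable Q k3 f3 T3].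
Proof.
move=> c1 c2 c3.
exists 1, (size P1).+1, (size P1 + size P2).+1 => e.
pose R P off := map (reloc (size P) off) P.
exists (e :: R P1 1 ++ R P2 (size P1).+1 ++ R P3 (size P1 + size P2).+1).
split=> //; [move: c1|move: c2|move: c3]; apply: computes_callable => i lt_i.
- by rewrite addn1 /= nth_cat size_map lt_i (nth_map Nil).
- rewrite addnS /= nth_cat size_map ifN ?addnK; last by rewrite -leqNgt leq_addl.
  by rewrite nth_cat size_map lt_i (nth_map Nil).
- rewrite addnS /= nth_cat size_map ifN; last by rewrite -leqNgt; lia.
  have -> : i + (size P1 + size P2) - size P1 = i + size P2 by lia.
  by rewrite nth_cat size_map ifN ?addnK ?(nth_map Nil) // -leqNgt leq_addl.
Qed.

Lemma link1 P f T : computes P f T ->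
  exists k, forall e, exists Q : program,
    [/\ 0 < size Q, nth Nil Q 0 = e & callable Q k f T].
Proof.
move=> c; have [k [k2 [k3 H]]] := link3 c c c; exists k => e.
by have [Q [? ? ? _ _]] := H e; exists Q.
Qed.

Lemma computes_id : computes [:: Var 0] id (fun=> 1).
Proof. by split=> // v; exists 1 => //; apply: (EvalVar _ [:: v]). Qed.

Lemma computes_leaf : computes [:: Nil] (fun=> Leaf) (fun=> 1).
Proof. by split=> // v; exists 1 => //; constructor. Qed.

Lemma computes_fst : computes [:: Case (Var 0) Nil (Var 0)] tfst (fun=> 3).
Proof.
split=> // -[|a b]; exists 3 => //=.
  by apply: (@EvalCaseLeaf _ _ _ _ _ _ 1 1); [apply: (EvalVar _ [:: Leaf]) | constructor].
apply: (@EvalCaseNode _ _ _ _ _ a b _ 1 1); first exact: (EvalVar _ [:: Node a b]).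
exact: (EvalVar _ [:: a; b; Node a b]).
Qed.

Lemma computes_snd : computes [:: Case (Var 0) Nil (Var 1)] tsnd (fun=> 3).
Proof.
split=> // -[|a b]; exists 3 => //=.
  by apply: (@EvalCaseLeaf _ _ _ _ _ _ 1 1); [apply: (EvalVar _ [:: Leaf]) | constructor].
apply: (@EvalCaseNode _ _ _ _ _ a b _ 1 1); first exact: (EvalVar _ [:: Node a b]).
exact: (EvalVar _ [:: a; b; Node a b] 1).
Qed.

Lemma computes_comp P1 P2 f g T S : computes P1 f T -> computes P2 g S ->
  exists P, computes P (g \o f) (fun v => T v + S (f v) + 3).
Proof.
move=> c1 c2; have [k1 [k2 [k3 H]]] := link3 c1 c2 c2.
have [Q [Q0 QE cf cg _]] := H (Call k2 (Call k1 (Var 0))).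
exists Q; split=> // v; rewrite QE.
have [t1 /cg[t2 e2 le2] le1] := cf _ _ _ _ (EvalVar Q [:: v] 0).
exists t2 => //=; move: le1 le2 => /=; lia.
Qed.

Lemma computes_node P1 P2 f g T S : computes P1 f T -> computes P2 g S ->
  exists P, computes P (fun v => Node (f v) (g v)) (fun v => T v + S v + 5).
Proof.
move=> c1 c2; have [k1 [k2 [k3 H]]] := link3 c1 c2 c2.
have [Q [Q0 QE cf cg _]] := H (Cons (Call k1 (Var 0)) (Call k2 (Var 0))).
exists Q; split=> // v; rewrite QE.
have [t1 e1 /= le1] := cf _ _ _ _ (EvalVar Q [:: v] 0).
have [t2 e2 /= le2] := cg _ _ _ _ (EvalVar Q [:: v] 0).
exists (t1 + t2).+1; first by constructor.
lia.
Qed.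

Lemma computes_if P1 P2 P3 c f g T S U :
  computes P1 (fun v => enc_bool (c v)) T -> computes P2 f S -> computes P3 g U ->
  exists P, computes P (fun v => if c v then f v else g v) (fun v => T v + S v + U v + 5).
Proof.
move=> c1 c2 c3; have [k1 [k2 [k3 H]]] := link3 c1 c2 c3.
(* A leaf encodes false, so [g] comes first; in the other branch two subtrees have been bound and
   the argument is [Var 2]. *)
have [Q [Q0 QE cc cf cg]] := H (Case (Call k1 (Var 0)) (Call k3 (Var 0)) (Call k2 (Var 2))).
exists Q; split=> // v; rewrite QE.
have [t1 e1 /= le1] := cc _ _ _ _ (EvalVar Q [:: v] 0).
have [t2 e2 /= le2] := cf _ _ _ _ (EvalVar Q [:: Leaf; Leaf; v] 2).
have [t3 e3 /= le3] := cg _ _ _ _ (EvalVar Q [:: v] 0).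
case: (c v) e1 => /= e1.
  by exists (t1 + t2).+1; [apply: EvalCaseNode e1 e2 | lia].
by exists (t1 + t3).+1; [apply: EvalCaseLeaf e1 e3 | lia].
Qed.

(** * Programs for equality of trees and for folds *)

Definition eq_expr : expr :=
  Case (Var 0) Nil
    (Case (Var 0)
      (Case (Var 1) (Cons Nil Nil) Nil)
      (Case (Var 3) Nil
        (Case (Call 0 (Cons (Var 2) (Var 0))) Nil
              (Call 0 (Cons (Var 5) (Var 3)))))).

(** Each recursive call descends to a child in both trees, so every node of [a] is visited at most
    once and the cost can be charged to [a] alone. *)
Lemma eval_eq (a b : tree) : exists2 t,
  eval [:: eq_expr] [:: Node a b] eq_expr (enc_bool (a == b)) t
  & t <= 15 * tree_size a.
Proof.
elim: a b => [|a1 IH1 a2 IH2] b.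
  case: b => [|b1 b2]; eexists; rewrite /eq_expr.
  - apply: EvalCaseNode; first exact: (EvalVar _ [:: _]).
    apply: EvalCaseLeaf; first exact: (EvalVar _ [:: _; _; _]).
    apply: EvalCaseLeaf; first exact: (EvalVar _ [:: _; _; _] 1).
    by constructor; constructor.
  - by [].
  - apply: EvalCaseNode; first exact: (EvalVar _ [:: _]).
    apply: EvalCaseLeaf; first exact: (EvalVar _ [:: _; _; _]).
    apply: EvalCaseNode; first exact: (EvalVar _ [:: _; _; _] 1).
    by constructor.
  - by [].
case: b => [|b1 b2].
  eexists; rewrite /eq_expr.
  - apply: EvalCaseNode; first exact: (EvalVar _ [:: _]).
    apply: EvalCaseNode; first exact: (EvalVar _ [:: _; _; _]).
    apply: EvalCaseLeaf; first exact: (EvalVar _ [:: _; _; _; _; _] 3).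
    by constructor.
  - by rewrite /=; lia.
have [t1 e1 le1] := IH1 b1; have [t2 e2 le2] := IH2 b2.
set env := [:: b1; b2; a1; a2; Node a1 a2; Node b1 b2; Node (Node a1 a2) (Node b1 b2)].
have E1 : eval [:: eq_expr] env (Call 0 (Cons (Var 2) (Var 0))) (enc_bool (a1 == b1)) (3 + t1).+1.
  apply: (@EvalCall _ _ 0 _ _ _ 3 _ _ e1); apply: (@EvalCons _ _ _ _ _ _ 1 1).
    exact: (EvalVar _ env 2).
  exact: (EvalVar _ env 0).
have E2 : eval [:: eq_expr] (Leaf :: Leaf :: env) (Call 0 (Cons (Var 5) (Var 3)))
    (enc_bool (a2 == b2)) (3 + t2).+1.
  apply: (@EvalCall _ _ 0 _ _ _ 3 _ _ e2); apply: (@EvalCons _ _ _ _ _ _ 1 1).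
    exact: (EvalVar _ (Leaf :: Leaf :: env) 5).
  exact: (EvalVar _ (Leaf :: Leaf :: env) 3).
have -> : (Node a1 a2 == Node b1 b2) = (a1 == b1) && (a2 == b2) by [].
have [t3 e3 le3] : exists2 t, eval [:: eq_expr] env
    (Case (Call 0 (Cons (Var 2) (Var 0))) Nil (Call 0 (Cons (Var 5) (Var 3))))
    (enc_bool ((a1 == b1) && (a2 == b2))) t & t <= t1 + t2 + 9.
  case: (a1 == b1) E1 => /= E1.
    by eexists; [apply: EvalCaseNode E1 E2 | lia].
  by eexists; [apply: EvalCaseLeaf E1 _; constructor | lia].
eexists.
  apply: EvalCaseNode; first exact: (EvalVar _ [:: _]).
  apply: EvalCaseNode; first exact: (EvalVar _ [:: _; _; _]).
  apply: EvalCaseNode; first exact: (EvalVar _ [:: _; _; _; _; _] 3).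
  exact: e3.
rewrite /=; lia.
Qed.

Definition eq_pair (v : tree) : tree := if v is Node a b then enc_bool (a == b) else Leaf.

Lemma computes_eq : computes [:: eq_expr] eq_pair (fun v => 15 * tree_size v).
Proof.
split=> // -[|a b] /=.
  exists 3 => //; apply: (@EvalCaseLeaf _ _ _ _ _ _ 1 1); last by constructor.
  exact: (EvalVar _ [:: Leaf]).
by have [t ev le] := eval_eq a b; exists t => //; lia.
Qed.

(** A tail-recursive loop on a context, an accumulator and a list. There are no closures, so
    whatever the step needs besides the accumulator and the element travels in the context, which
    stays unchanged. *)
Definition fold_expr (k : nat) : expr :=
  Case (Var 0) Nil
    (Case (Var 1) Nil
      (Case (Var 1) (Var 0)
        (Call 0 (Cons (Var 4)
          (Cons (Call k (Cons (Var 4) (Cons (Var 0) (Var 2)))) (Var 1)))))).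

Definition fold_step (h : tree -> tree) (c a x : tree) : tree := h (Node c (Node x a)).

Definition fold_pair (h : tree -> tree) (v : tree) : tree :=
  if v is Node c (Node a l) then foldl (fold_step h c) a (spine l) else Leaf.

Fixpoint fold_time (h : tree -> tree) (T : tree -> nat) (c a : tree) (s : seq tree) : nat :=
  if s is x :: s' then T (Node c (Node x a)) + fold_time h T c (fold_step h c a x) s' + 20
  else 20.

Definition fold_pair_time (h : tree -> tree) (T : tree -> nat) (v : tree) : nat :=
  if v is Node c (Node a l) then fold_time h T c a (spine l) else 20.

Lemma computes_fold P h T : computes P h T ->
  exists Q, computes Q (fold_pair h) (fold_pair_time h T).
Proof.
move=> c1; have [k H] := link1 c1; have [Q [Q0 QE ch]] := H (fold_expr k).
exists Q; split=> //; rewrite QE => -[|c [|a l]] /=.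
- exists 3 => //; apply: (@EvalCaseLeaf _ _ _ _ _ _ 1 1); last by constructor.
  exact: (EvalVar _ [:: Leaf]).
- exists 5 => //; apply: (@EvalCaseNode _ _ _ _ _ _ _ _ 1 3).
    exact: (EvalVar _ [:: Node _ _]).
  apply: (@EvalCaseLeaf _ _ _ _ _ _ 1 1); last by constructor.
  exact: (EvalVar _ [:: _; _; _] 1).
elim: l a => [|x _ l IH] a /=.
  exists 7 => //; apply: (@EvalCaseNode _ _ _ _ _ _ _ _ 1 5).
    exact: (EvalVar _ [:: Node _ _]).
  apply: (@EvalCaseNode _ _ _ _ _ _ _ _ 1 3); first exact: (EvalVar _ [:: _; _; _] 1).
  apply: (@EvalCaseLeaf _ _ _ _ _ _ 1 1); first exact: (EvalVar _ [:: _; _; _; _; _] 1).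
  exact: (EvalVar _ [:: _; _; _; _; _] 0).
set env := [:: x; l; a; Node x l; c; Node a (Node x l); Node c (Node a (Node x l))].
have E : eval Q env (Cons (Var 4) (Cons (Var 0) (Var 2))) (Node c (Node x a)) 5.
  apply: (@EvalCons _ _ _ _ _ _ 1 3); first exact: (EvalVar _ env 4).
  apply: (@EvalCons _ _ _ _ _ _ 1 1); first exact: (EvalVar _ env 0).
  exact: (EvalVar _ env 2).
have [t1 e1 le1] := ch _ _ _ _ E.
have [t2 e2 le2] := IH (fold_step h c a x).
exists ((1 + (1 + (1 + ((1 + (t1 + 1).+1).+1 + t2).+1).+1).+1).+1); last by lia.
apply: EvalCaseNode; first exact: (EvalVar _ [:: Node _ _]).
apply: EvalCaseNode; first exact: (EvalVar _ [:: _; _; _] 1).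
apply: EvalCaseNode; first exact: (EvalVar _ [:: _; _; _; _; _] 1).
apply: EvalCall; last by rewrite QE; exact: e2.
apply: EvalCons; first exact: (EvalVar _ env 4).
apply: EvalCons; first exact: e1.
exact: (EvalVar _ env 1).
Qed.

(** Instantiated below by polynomials and by towers of exponentials. The closure conditions are
    those needed to compose programs and to bound folds, so the calculus of feasible functions is
    developed once for both. *)
Record bound_family : Type := BoundFamily {
  bd :> nat -> nat -> nat;
  bd_homo : forall a, {homo bd a : m n / m <= n};
  bd_id : exists a, forall n, n <= bd a n;
  bd_const : forall m, exists a, forall n, m <= bd a n;
  bd_add : forall a b, exists c, forall n, bd a n + bd b n <= bd c n;
  bd_mul : forall a b, exists c, forall n, bd a n * bd b n <= bd c n;
  bd_comp : forall a b, exists c, forall n, bd a (bd b n) <= bd c n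
}.

Section Bounds.
Variable B : bound_family.

Definition bounded (b : nat -> nat) : Prop := exists a, forall n, b n <= B a n.

Lemma bounded_id : bounded id. Proof. exact: bd_id. Qed.
Lemma bounded_const m : bounded (fun=> m). Proof. exact: bd_const. Qed.

Lemma bounded_bd a : bounded (B a). Proof. by exists a. Qed.

Lemma bounded_add b1 b2 : bounded b1 -> bounded b2 -> bounded (fun n => b1 n + b2 n).
Proof.
move=> [a1 h1] [a2 h2]; have [c hc] := bd_add B a1 a2.
by exists c => n; apply: leq_trans (hc n); apply: leq_add.
Qed.

Lemma bounded_mul b1 b2 : bounded b1 -> bounded b2 -> bounded (fun n => b1 n * b2 n).
Proof.
move=> [a1 h1] [a2 h2]; have [c hc] := bd_mul B a1 a2.
by exists c => n; apply: leq_trans (hc n); apply: leq_mul.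
Qed.

Lemma bounded_comp a b : bounded b -> bounded (fun n => B a (b n)).
Proof.
move=> [a2 h2]; have [c hc] := bd_comp B a a2.
by exists c => n; apply: leq_trans (hc n); apply: bd_homo.
Qed.

Lemma bounded_succ b : bounded b -> bounded (fun n => (b n).+1).
Proof.
move=> h; have [a ha] := bounded_add h (bounded_const 1).
by exists a => n; rewrite -addn1.
Qed.

(** The bound on the output size does not follow from the one on time: repeatedly pairing a value
    with itself doubles its size at constant cost. Composition needs both bounds. *)
Definition feasible (f : tree -> tree) : Prop :=
  exists P T a, [/\ computes P f T, forall v, T v <= B a (tree_size v)
    & forall v, tree_size (f v) <= B a (tree_size v)].

Lemma feasible_intro P f T b s :
  computes P f T -> bounded b -> (forall v, T v <= b (tree_size v)) ->
  bounded s -> (forall v, tree_size (f v) <= s (tree_size v)) -> feasible f.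
Proof.
move=> c hb hT hs hS; have [a ha] := bounded_add hb hs.
exists P, T, a; split=> // v; apply: leq_trans (ha _).
  exact: leq_trans (hT v) (leq_addr _ _).
exact: leq_trans (hS v) (leq_addl _ _).
Qed.

Lemma feasible_ext f g : f =1 g -> feasible f -> feasible g.
Proof.
move=> fg [P [T [a [[P0 c] hT hS]]]]; exists P, T, a; split=> // [|v].
  by split=> // v; rewrite -fg.
by rewrite -fg.
Qed.

Lemma feasible_id : feasible (fun v => v).
Proof.
exact: (feasible_intro computes_id (bounded_const 1) _ bounded_id).
Qed.

Lemma feasible_leaf : feasible (fun=> Leaf).
Proof. exact: (feasible_intro computes_leaf (bounded_const 1) _ (bounded_const 1)). Qed.

Lemma feasible_comp g f : feasible g -> feasible f -> feasible (fun v => g (f v)).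
Proof.
move=> [P2 [T2 [a2 [c2 hT2 hS2]]]] [P1 [T1 [a1 [c1 hT1 hS1]]]].
have [P c] := computes_comp c1 c2.
have hb := bounded_comp a2 (bounded_bd a1).
apply: (feasible_intro c (bounded_add (bounded_add (bounded_bd a1) hb) (bounded_const 3)) _ hb) => v.
  rewrite leq_add2r; apply: leq_add (hT1 v) _.
  by apply: leq_trans (hT2 _) _; apply: bd_homo.
by apply: leq_trans (hS2 _) _; apply: bd_homo.
Qed.

Lemma feasible_fst f : feasible f -> feasible (fun v => tfst (f v)).
Proof.
apply: feasible_comp.
exact: (feasible_intro computes_fst (bounded_const 3) _ bounded_id tree_size_fst).
Qed.

Lemma feasible_snd f : feasible f -> feasible (fun v => tsnd (f v)).
Proof.
apply: feasible_comp.
exact: (feasible_intro computes_snd (bounded_const 3) _ bounded_id tree_size_snd).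
Qed.

Lemma feasible_node f g : feasible f -> feasible g -> feasible (fun v => Node (f v) (g v)).
Proof.
move=> [P1 [T1 [a1 [c1 hT1 hS1]]]] [P2 [T2 [a2 [c2 hT2 hS2]]]].
have [P c] := computes_node c1 c2.
have hb := bounded_add (bounded_add (bounded_bd a1) (bounded_bd a2)) (bounded_const 5).
apply: (feasible_intro c hb _ hb) => v /=; move: (hT1 v) (hT2 v) (hS1 v) (hS2 v); lia.
Qed.

Definition feasible_bool (c : tree -> bool) : Prop := feasible (fun v => enc_bool (c v)).

Lemma feasible_if c f g : feasible_bool c -> feasible f -> feasible g ->
  feasible (fun v => if c v then f v else g v).
Proof.
move=> [P3 [T3 [a3 [c3 hT3 hS3]]]] [P1 [T1 [a1 [c1 hT1 hS1]]]] [P2 [T2 [a2 [c2 hT2 hS2]]]].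
have [P cP] := computes_if c3 c1 c2.
have hb := bounded_add (bounded_add (bounded_add (bounded_bd a3) (bounded_bd a1))
  (bounded_bd a2)) (bounded_const 5).
apply: (feasible_intro cP hb _ hb) => v /=.
  by move: (hT1 v) (hT2 v) (hT3 v); lia.
by case: (c v); move: (hS1 v) (hS2 v); lia.
Qed.

Lemma feasible_eq f g : feasible f -> feasible g -> feasible_bool (fun v => f v == g v).
Proof.
move=> hf hg; have h : feasible eq_pair.
  apply: (feasible_intro computes_eq (bounded_mul (bounded_const 15) bounded_id) _
    (bounded_const 3)) => // -[|a b] //=.
  by case: (a == b).
exact: (feasible_comp h (feasible_node hf hg)).
Qed.

Lemma feasible_fold_pair h : feasible h ->
  (exists a, forall c x l, tree_size (foldl (fold_step h c) x l)
     <= B a (tree_size c + tree_size x + tree_size (lst l))) ->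
  feasible (fold_pair h).
Proof.
move=> [P [T [a [cP hT hS]]]] [a2 h2].
have [Q cQ] := computes_fold cP.
(* [B a2 n] bounds every intermediate accumulator and [n] the context with the current element, so
   [b1] bounds the time of one step. *)
pose b1 n := B a (B a2 n + n + 5).
have bb1 : bounded b1.
  by apply: bounded_comp; do 2?apply: bounded_add;
    [exact: bounded_bd | exact: bounded_id | exact: bounded_const].
have bb : bounded (fun n => (n + 1) * (b1 n + 20)).
  by apply: bounded_mul; apply: bounded_add;
    [exact: bounded_id | exact: bounded_const | exact: bb1 | exact: bounded_const].
apply: (feasible_intro cQ bb _ (bounded_add (bounded_const 1) (bounded_bd a2))) => -[|c [|x l]] //=.
- lia.
- lia.
- set N := _.+1.
  (* The accumulator reached after a prefix [s1] is itself a fold over [s1], so the size hypothesis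
     applies to it; the induction is on the remaining list. *)
  suff gen s1 s2 : s1 ++ s2 = spine l ->
      fold_time h T c (foldl (fold_step h c) x s1) s2 <= (size s2 + 1) * (b1 N + 20).
    apply: leq_trans (gen [::] _ erefl) _; rewrite leq_mul2r; apply/orP; right.
    by have := size_lst (spine l); rewrite spineK /N; lia.
  elim: s2 s1 => [|y s2 IH] s1 E /=; first by lia.
  have := IH (rcons s1 y); rewrite cat_rcons foldl_rcons => /(_ E) le1.
  set X := foldl _ _ _ in le1 *; set n := (size s2).
  have le2 : T (Node c (Node y X)) <= b1 N.
    apply: leq_trans (hT _) _; apply: bd_homo => /=.
    have := h2 c x s1; rewrite -/X => leX.
    have := tree_size_cat s1 (y :: s2); rewrite E spineK /= => El.
    have leB : tree_size X <= B a2 N.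
      by apply: leq_trans leX _; apply: bd_homo; rewrite /N; lia.
    have : tree_size c + tree_size y <= N by rewrite /N; lia.
    lia.
  rewrite -/n in le1; nia.
- apply: leq_trans (h2 c x (spine l)) _; rewrite spineK.
  by apply: leq_trans (leq_addl _ _); apply: bd_homo; lia.
Qed.

(** The whole input [v] is passed as the context, so the step may depend on it. *)
Lemma feasible_fold_gen (step : tree -> tree -> tree -> tree) base l :
  feasible (fun p => step (tfst p) (tsnd (tsnd p)) (tfst (tsnd p))) ->
  feasible base -> feasible l ->
  (exists a, forall c x s, tree_size (foldl (step c) x s)
     <= B a (tree_size c + tree_size x + tree_size (lst s))) ->
  feasible (fun v => foldl (step v) (base v) (spine (l v))).
Proof.
move=> hs hb hl hB; have := feasible_fold_pair hs hB.
move=> /feasible_comp /(_ (feasible_node feasible_id (feasible_node hb hl))).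
by apply: feasible_ext.
Qed.

(* An accumulator growing by an amount that does not depend on the accumulator
   stays bounded; unrestricted folds could double it at each step. *)
Lemma feasible_fold (step : tree -> tree -> tree -> tree) base l :
  feasible (fun p => step (tfst p) (tsnd (tsnd p)) (tfst (tsnd p))) ->
  feasible base -> feasible l ->
  (exists a, forall c x y, tree_size (step c x y)
     <= tree_size x + B a (tree_size c + tree_size y)) ->
  feasible (fun v => foldl (step v) (base v) (spine (l v))).
Proof.
move=> hs hb hl [a ha]; apply: feasible_fold_gen => //.
have [a' ha'] : bounded (fun n => n + n * B a n).
  by apply: bounded_add; [|apply: bounded_mul; [|exact: bounded_bd]]; exact: bounded_id.
exists a' => c x s; apply: leq_trans (ha' _).
suff gen : tree_size (foldl (step c) x s)
    <= tree_size x + size s * B a (tree_size c + tree_size (lst s)).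
  apply: leq_trans gen _; apply: leq_add; first by lia.
  by apply: leq_mul; [have := size_lst s; lia | apply: bd_homo; lia].
elim: s x => [|y s IH] x /=; first by rewrite leq_addr.
apply: leq_trans (IH _) _.
have le1 := ha c x y.
have le2 : B a (tree_size c + tree_size y) <= B a (tree_size c + (tree_size y + tree_size (lst s)).+1).
  by apply: bd_homo; lia.
have le3 : B a (tree_size c + tree_size (lst s)) <= B a (tree_size c + (tree_size y + tree_size (lst s)).+1).
  by apply: bd_homo; lia.
nia.
Qed.

End Bounds.

(** * Closure properties of feasible functions *)

Definition tzip (s t : seq tree) : seq tree := [seq Node p.1 p.2 | p <- zip s t].

Section FeasibleOperations.
Variable B : bound_family.

Definition feasible_seq (s : tree -> seq tree) : Prop := feasible B (fun v => lst (s v)).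
(** Numbers are unary, so that arithmetic and comparison are list operations and a number can serve
    as the counter of a fold. *)
Definition feasible_nat (n : tree -> nat) : Prop := feasible B (fun v => unary (n v)).

Lemma feasible_app2 (g : tree -> tree -> tree) a b :
  feasible B (fun p => g (tfst p) (tsnd p)) -> feasible B a -> feasible B b ->
  feasible B (fun v => g (a v) (b v)).
Proof. by move=> hg ha hb; exact: (feasible_comp hg (feasible_node ha hb)). Qed.

Lemma feasible_size2 (g : tree -> tree -> tree) :
  feasible B (fun p => g (tfst p) (tsnd p)) ->
  exists a, forall c y, tree_size (g c y) <= B a (tree_size c + tree_size y).
Proof.
move=> [_ [_ [a [_ _ h]]]].
have [a' ha'] := bounded_comp a (bounded_succ (bounded_id B)).
by exists a' => c y; apply: leq_trans (h (Node c y)) (ha' _).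
Qed.

Lemma feasible_seq_comp s f : feasible_seq s -> feasible B f -> feasible_seq (fun v => s (f v)).
Proof. exact: feasible_comp. Qed.

Lemma feasible_nat_comp n f : feasible_nat n -> feasible B f -> feasible_nat (fun v => n (f v)).
Proof. exact: feasible_comp. Qed.

Lemma feasible_bool_comp c f :
  feasible_bool B c -> feasible B f -> feasible_bool B (fun v => c (f v)).
Proof. exact: feasible_comp. Qed.

Lemma feasible_lst s : feasible_seq s -> feasible B (fun v => lst (s v)).
Proof. by []. Qed.

Lemma feasible_spine f : feasible B f -> feasible_seq (fun v => spine (f v)).
Proof. by apply: feasible_ext => v; rewrite spineK. Qed.

Lemma feasible_nil : feasible_seq (fun=> [::]).
Proof. exact: feasible_leaf. Qed.

Lemma feasible_cons f s : feasible B f -> feasible_seq s -> feasible_seq (fun v => f v :: s v).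
Proof. by move=> hf hs; apply: feasible_node. Qed.

Lemma feasible_nseq n : feasible_nat n -> feasible_seq (fun v => nseq (n v) Leaf).
Proof. by []. Qed.

Lemma feasible_true : feasible_bool B (fun=> true).
Proof. by apply: feasible_node; exact: feasible_leaf. Qed.

Lemma feasible_false : feasible_bool B (fun=> false).
Proof. exact: feasible_leaf. Qed.

Lemma feasible_ifb c f g : feasible_bool B c -> feasible_bool B f -> feasible_bool B g ->
  feasible_bool B (fun v => if c v then f v else g v).
Proof.
move=> hc hf hg; have := feasible_if hc hf hg.
by apply: feasible_ext => v; case: (c v).
Qed.

Lemma feasible_ifs c f g : feasible_bool B c -> feasible_seq f -> feasible_seq g ->
  feasible_seq (fun v => if c v then f v else g v).
Proof.
move=> hc hf hg; have := feasible_if hc hf hg.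
by apply: feasible_ext => v; case: (c v).
Qed.

Lemma feasible_not c : feasible_bool B c -> feasible_bool B (fun v => ~~ c v).
Proof.
move=> hc; have := feasible_ifb hc feasible_false feasible_true.
by apply: feasible_ext => v; case: (c v).
Qed.

Lemma feasible_and c d : feasible_bool B c -> feasible_bool B d ->
  feasible_bool B (fun v => c v && d v).
Proof.
move=> hc hd; have := feasible_ifb hc hd feasible_false.
by apply: feasible_ext => v; case: (c v).
Qed.

Lemma feasible_or c d : feasible_bool B c -> feasible_bool B d ->
  feasible_bool B (fun v => c v || d v).
Proof.
move=> hc hd; have := feasible_ifb hc feasible_true hd.
by apply: feasible_ext => v; case: (c v).
Qed.

Lemma feasible_nilp s : feasible_seq s -> feasible_bool B (fun v => nilp (s v)).
Proof.
move=> hs; have := feasible_eq hs (feasible_leaf B).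
by apply: feasible_ext => v; case: (s v).
Qed.

Lemma feasible_foldl (step : tree -> tree -> tree -> tree) base l :
  feasible B (fun p => step (tfst p) (tsnd (tsnd p)) (tfst (tsnd p))) ->
  feasible B base -> feasible_seq l ->
  (exists a, forall c x y, tree_size (step c x y)
     <= tree_size x + B a (tree_size c + tree_size y)) ->
  feasible B (fun v => foldl (step v) (base v) (l v)).
Proof.
move=> hs hb hl hB; have := feasible_fold hs hb hl hB.
by apply: feasible_ext => v; rewrite lstK.
Qed.

Lemma feasible_foldl0 (step : tree -> tree -> tree -> tree) base l :
  feasible B (fun p => step (tfst p) (tsnd (tsnd p)) (tfst (tsnd p))) ->
  feasible B base -> feasible_seq l ->
  (forall c x y, tree_size (step c x y) <= tree_size x + tree_size c + tree_size y + 9) ->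
  feasible B (fun v => foldl (step v) (base v) (l v)).
Proof.
move=> hs hb hl h; apply: feasible_foldl => //.
have [a ha] := bounded_add (bounded_id B) (bounded_const B 9).
by exists a => c x y; move: (ha (tree_size c + tree_size y)) (h c x y) => /=; lia.
Qed.

Lemma feasible_catrev s t : feasible_seq s -> feasible_seq t ->
  feasible_seq (fun v => catrev (s v) (t v)).
Proof.
move=> hs ht.
suff : feasible B (fun v => foldl (fun x y => Node y x) (lst (t v)) (s v)).
  apply: feasible_ext => v; elim: (s v) (t v) => //= x s' IH t'.
  by rewrite -IH.
apply: (feasible_foldl0 (step := fun _ x y => Node y x)) => //.
  by apply: feasible_node; [apply: feasible_fst; apply: feasible_snd|
    do 2!apply: feasible_snd]; exact: feasible_id.
by move=> * /=; lia.
Qed.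

Lemma feasible_rev s : feasible_seq s -> feasible_seq (fun v => rev (s v)).
Proof. by move=> hs; apply: feasible_catrev => //; exact: feasible_nil. Qed.

Lemma feasible_cat s t : feasible_seq s -> feasible_seq t ->
  feasible_seq (fun v => s v ++ t v).
Proof.
move=> /feasible_rev hs ht; have := feasible_catrev hs ht.
by apply: feasible_ext => v; rewrite catrevE revK.
Qed.

(** The list is traversed backwards and each block is prepended to the accumulator, which thus grows
    by the size of the block, whatever it already contains. *)
Lemma feasible_flatten (g : tree -> tree -> seq tree) l :
  feasible_seq (fun p => g (tfst p) (tsnd p)) -> feasible_seq l ->
  feasible_seq (fun v => flatten [seq g v x | x <- l v]).
Proof.
move=> hg hl.
suff : feasible_seq (fun v => spine (foldl (fun x y => lst (g v y ++ spine x)) Leaf (rev (l v)))).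
  apply: feasible_ext => v; congr lst; rewrite -[l v in RHS]revK.
  elim/last_ind: (rev (l v)) => // s x IH.
  by rewrite foldl_rcons lstK IH rev_rcons.
apply: feasible_spine.
apply: (feasible_foldl (step := fun c x y => lst (g c y ++ spine x))).
- apply: (@feasible_cat (fun p => g (tfst p) (tfst (tsnd p))) (fun p => spine (tsnd (tsnd p)))).
    apply: (@feasible_app2 (fun x y => lst (g x y))) => //.
      by apply: feasible_fst; exact: feasible_id.
    by apply: feasible_fst; apply: feasible_snd; exact: feasible_id.
  by apply: feasible_spine; do 2!apply: feasible_snd; exact: feasible_id.
- exact: feasible_leaf.
- exact: feasible_rev.
- have [a ha] := @feasible_size2 (fun x y => lst (g x y)) hg.
  exists a => c x y; have := tree_size_cat (g c y) (spine x); rewrite spineK.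
  by have := ha c y; lia.
Qed.

Lemma feasible_map (g : tree -> tree -> tree) l :
  feasible B (fun p => g (tfst p) (tsnd p)) -> feasible_seq l ->
  feasible_seq (fun v => [seq g v x | x <- l v]).
Proof.
move=> hg hl.
have := @feasible_flatten (fun x y => [:: g x y]) _ (feasible_cons hg feasible_nil) hl.
by apply: feasible_ext => v; congr lst; elim: (l v) => //= x s ->.
Qed.

Lemma feasible_filter (q : tree -> tree -> bool) l :
  feasible_bool B (fun p => q (tfst p) (tsnd p)) -> feasible_seq l ->
  feasible_seq (fun v => [seq x <- l v | q v x]).
Proof.
move=> hq hl.
have h : feasible_seq (fun p => if q (tfst p) (tsnd p) then [:: tsnd p] else [::]).
  apply: feasible_ifs => //; last exact: feasible_nil.
  by apply: feasible_cons (feasible_nil); apply: feasible_snd; exact: feasible_id.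
have := @feasible_flatten (fun x y => if q x y then [:: y] else [::]) _ h hl.
by apply: feasible_ext => v; congr lst; elim: (l v) => //= x s ->; case: (q v x).
Qed.

Lemma feasible_size s : feasible_seq s -> feasible_nat (fun v => size (s v)).
Proof.
move=> hs; have := feasible_map (g := fun _ _ => Leaf) (feasible_leaf B) hs.
by apply: feasible_ext => v; congr lst; elim: (s v) => //= _ t ->.
Qed.

Lemma feasible_count (q : tree -> tree -> bool) l :
  feasible_bool B (fun p => q (tfst p) (tsnd p)) -> feasible_seq l ->
  feasible_nat (fun v => count (q v) (l v)).
Proof.
move=> hq hl; have := feasible_size (feasible_filter hq hl).
by apply: feasible_ext => v; rewrite size_filter.
Qed.

Lemma feasible_has (q : tree -> tree -> bool) l :
  feasible_bool B (fun p => q (tfst p) (tsnd p)) -> feasible_seq l ->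
  feasible_bool B (fun v => has (q v) (l v)).
Proof.
move=> hq hl; have := feasible_not (feasible_nilp (feasible_filter hq hl)).
by apply: feasible_ext => v; rewrite /nilp size_filter has_count lt0n.
Qed.

Lemma feasible_all (q : tree -> tree -> bool) l :
  feasible_bool B (fun p => q (tfst p) (tsnd p)) -> feasible_seq l ->
  feasible_bool B (fun v => all (q v) (l v)).
Proof.
move=> hq hl; have := feasible_not (feasible_has (q := fun v x => ~~ q v x) (feasible_not hq) hl).
by apply: feasible_ext => v; rewrite has_predC negbK.
Qed.

Lemma feasible_mem f s : feasible B f -> feasible_seq s ->
  feasible_bool B (fun v => f v \in s v).
Proof.
move=> hf hs; have := feasible_has (q := fun v x => x == f v) _ hs.
move=> /(_ _)/feasible_ext; apply; first by move=> v; rewrite has_pred1.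
apply: feasible_eq; first by apply: feasible_snd; exact: feasible_id.
by apply: feasible_comp hf _; apply: feasible_fst; exact: feasible_id.
Qed.

Lemma feasible_sum (g : tree -> tree -> nat) l :
  feasible_nat (fun p => g (tfst p) (tsnd p)) -> feasible_seq l ->
  feasible_nat (fun v => sumn [seq g v x | x <- l v]).
Proof.
move=> hg hl; have := @feasible_flatten (fun x y => nseq (g x y) Leaf) _ hg hl.
apply: feasible_ext => v; congr lst; elim: (l v) => //= x s ->.
by rewrite -nseqD.
Qed.

Lemma feasible_mul m n : feasible_nat m -> feasible_nat n ->
  feasible_nat (fun v => m v * n v).
Proof.
move=> hm hn; have := @feasible_sum (fun v _ => n v) _ _ (feasible_nseq hm).
move=> /(_ _)/feasible_ext; apply.
  by move=> v; rewrite map_nseq sumn_nseq mulnC.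
by apply: feasible_nat_comp hn _; apply: feasible_fst; exact: feasible_id.
Qed.

Lemma feasible_add m n : feasible_nat m -> feasible_nat n ->
  feasible_nat (fun v => m v + n v).
Proof.
move=> hm hn; have := feasible_cat hm hn.
by apply: feasible_ext => v; rewrite /unary -nseqD.
Qed.

Lemma feasible_const k : feasible_nat (fun=> k).
Proof.
elim: k => [|k IH]; first exact: feasible_leaf.
exact: feasible_cons (feasible_leaf B) IH.
Qed.

(** The unary number is used as a counter for iterating [tsnd]; since [tsnd Leaf] is [Leaf], lists
    that are too short cause no harm. *)
Lemma feasible_drop n s : feasible_nat n -> feasible_seq s ->
  feasible_seq (fun v => drop (n v) (s v)).
Proof.
move=> hn hs.
suff : feasible B (fun v => foldl (fun x _ => tsnd x) (lst (s v)) (nseq (n v) Leaf)).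
  apply: feasible_ext => v; elim: (n v) (s v) => [|k IH] [|x t] //=.
  by rewrite (IH [::]) drop_oversize.
apply: (feasible_foldl0 (step := fun _ x _ => tsnd x)) => //.
  by do 3!apply: feasible_snd; exact: feasible_id.
by move=> c x y; have := tree_size_snd x; lia.
Qed.

Lemma feasible_head d s : feasible B d -> feasible_seq s ->
  feasible B (fun v => head (d v) (s v)).
Proof.
move=> hd hs; have := feasible_if (feasible_nilp hs) hd (feasible_fst hs).
by apply: feasible_ext => v; case: (s v).
Qed.

Lemma feasible_nth d s n : feasible B d -> feasible_seq s -> feasible_nat n ->
  feasible B (fun v => nth (d v) (s v) (n v)).
Proof.
move=> hd hs hn; have := feasible_head hd (feasible_drop hn hs).
by apply: feasible_ext => v; rewrite -nth0 nth_drop addn0.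
Qed.

Lemma feasible_leq m n : feasible_nat m -> feasible_nat n ->
  feasible_bool B (fun v => m v <= n v).
Proof.
move=> hm hn; have := feasible_nilp (feasible_drop hn (feasible_nseq hm)).
by apply: feasible_ext => v; rewrite /nilp size_drop size_nseq.
Qed.

Lemma feasible_eqn m n : feasible_nat m -> feasible_nat n ->
  feasible_bool B (fun v => m v == n v).
Proof.
move=> hm hn; have := feasible_and (feasible_leq hm hn) (feasible_leq hn hm).
by apply: feasible_ext => v; rewrite eqn_leq.
Qed.

Lemma feasible_undup s : feasible_seq s -> feasible_seq (fun v => undup (s v)).
Proof.
move=> hs.
suff : feasible B (fun v => foldl (fun x y => if y \in spine x then x else Node y x)
    Leaf (rev (s v))).
  apply: feasible_ext => v; elim: (s v) => //= x t IH.
  by rewrite rev_cons foldl_rcons IH lstK mem_undup; case: ifP.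
apply: (feasible_foldl0 (step := fun _ x y => if y \in spine x then x else Node y x)).
- have h1 : feasible B (fun p => tsnd (tsnd p)) by do 2!apply: feasible_snd; exact: feasible_id.
  have h2 : feasible B (fun p => tfst (tsnd p)).
    by apply: feasible_fst; apply: feasible_snd; exact: feasible_id.
  apply: feasible_if => //; last exact: feasible_node.
  by apply: feasible_mem => //; exact: feasible_spine.
- exact: feasible_leaf.
- exact: feasible_rev.
- by move=> c x y; case: ifP => /=; lia.
Qed.

(** The state holds what is left of the second list and the reversed result; it no longer changes
    once the second list is exhausted. *)
Definition zip_step (st x : tree) : tree :=
  if st is Node (Node y t) s then Node t (Node (Node x y) s) else st.

Lemma foldl_zip_step s t u : tsnd (foldl zip_step (Node (lst t) (lst u)) s)
  = lst (catrev (tzip s t) u).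
Proof.
elim: s t u => [|x s IH] [|y t] u //=; last by rewrite -IH.
by rewrite (_ : foldl _ _ _ = Node Leaf (lst u)) //; elim: s {IH}.
Qed.

Lemma feasible_zip s t : feasible_seq s -> feasible_seq t ->
  feasible_seq (fun v => tzip (s v) (t v)).
Proof.
move=> hs ht.
suff h : feasible B (fun v => tsnd (foldl zip_step (Node (lst (t v)) Leaf) (s v))).
  have := feasible_rev (feasible_spine h).
  by apply: feasible_ext => v; rewrite (foldl_zip_step _ _ [::]) lstK catrevE cats0 revK.
apply: feasible_snd.
apply: (feasible_foldl0 (step := fun _ => zip_step)) => //.
- have h1 : feasible B (fun p => tsnd (tsnd p)) by do 2!apply: feasible_snd; exact: feasible_id.
  have h2 : feasible B (fun p => tfst (tsnd p)).
    by apply: feasible_fst; apply: feasible_snd; exact: feasible_id.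
  have h3 : feasible B (fun p => tfst (tsnd (tsnd p))) by exact: feasible_fst.
  have := feasible_if (feasible_nilp (feasible_spine h3)) h1
     (feasible_node (feasible_snd h3)
       (feasible_node (feasible_node h2 (feasible_fst h3)) (feasible_snd h1))).
  by apply: feasible_ext => v; case: (tsnd (tsnd v)) => [|[|y r] z].
- by apply: feasible_node => //; exact: feasible_leaf.
- by move=> c [|[|y r] z] x /=; lia.
Qed.

End FeasibleOperations.

(** * Checking an advice *)

(** Below a fold, map or filter the original input has become a component of a pair. A hypothesis on
    a function of that input is then used through composition with the projection. *)
Ltac feasible_var :=
  match goal with
  | H : feasible_bool _ ?c |- feasible_bool _ (fun p => ?c _) => apply: (feasible_bool_comp H)
  | H : feasible_nat _ ?c |- feasible_nat _ (fun p => ?c _) => apply: (feasible_nat_comp H)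
  | H : feasible_seq _ ?c |- feasible_seq _ (fun p => ?c _) => apply: (feasible_seq_comp H)
  | H : feasible _ ?c |- feasible _ (fun p => ?c _) => apply: (feasible_comp H)
  end.
Ltac feasible_step :=
  cbv beta; lazymatch goal with
  | H : ?G |- ?G => exact: H
  | |- feasible _ tfst => apply: feasible_fst (feasible_id _)
  | |- feasible _ tsnd => apply: feasible_snd (feasible_id _)
  | |- feasible_bool _ (fun p => @?c p) => first [assumption | feasible_var |
    lazymatch c with
    | fun p => true => apply: feasible_true
    | fun p => false => apply: feasible_false
    | fun p => ~~ _ => apply: feasible_not
    | fun p => _ && _ => apply: feasible_and
    | fun p => _ || _ => apply: feasible_or
    | fun p => leq _ _ => apply: feasible_leq
    | fun p => nilp _ => apply: feasible_nilp
    | fun p => all _ _ => apply: feasible_all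
    | fun p => has _ _ => apply: feasible_has
    | fun p => _ \in _ => apply: feasible_mem
    | fun p => _ == _ => first [apply: feasible_eq | apply: feasible_eqn]
    end]
  | |- feasible_nat _ (fun p => @?c p) => first [assumption | feasible_var |
    lazymatch c with
    | fun p => muln _ _ => apply: feasible_mul
    | fun p => addn _ _ => apply: feasible_add
    | fun p => size _ => apply: feasible_size
    | fun p => count_mem _ _ => apply: (feasible_count (q := fun v x => x == _))
    | fun p => count _ _ => apply: feasible_count
    | fun p => sumn (map _ _) => apply: feasible_sum
    end]
  | |- feasible_seq _ (fun p => @?c p) => first [assumption | feasible_var |
    lazymatch c with
    | fun p => [::] => apply: feasible_nil
    | fun p => _ :: _ => apply: feasible_cons
    | fun p => nseq _ Leaf => apply: feasible_nseq
    | fun p => rev _ => apply: feasible_rev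
    | fun p => _ ++ _ => apply: feasible_cat
    | fun p => spine _ => apply: feasible_spine
    | fun p => drop _ _ => apply: feasible_drop
    | fun p => undup _ => apply: feasible_undup
    | fun p => tzip _ _ => apply: feasible_zip
    | fun p => map _ _ => apply: feasible_map
    | fun p => filter _ _ => apply: feasible_filter
    end]
  | |- feasible _ (fun p => @?c p) => first [assumption | apply: feasible_id | feasible_var |
    lazymatch c with
    | fun p => Leaf => apply: feasible_leaf
    | fun p => tfst _ => apply: feasible_fst
    | fun p => tsnd _ => apply: feasible_snd
    | fun p => Node _ _ => apply: feasible_node
    | fun p => lst _ => apply: feasible_lst
    | fun p => if _ then _ else _ => apply: feasible_if
    | fun p => head _ _ => apply: feasible_head
    | fun p => nth _ _ _ => apply: feasible_nth
    end]
  end.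
Ltac feasible_tac := repeat feasible_step.

(** Elements of [R] are pairs of a color and a row. The test compares the distributions of [c] and
    [c0] over the rows, cross-multiplied; a row absent from [R] would give zero on both sides. *)
Definition proportional (R : seq tree) (c c0 : tree) : bool :=
  all (fun a =>
         count_mem (Node c (tsnd a)) R * count (fun b => tfst b == c0) R
      == count_mem (Node c0 (tsnd a)) R * count (fun b => tfst b == c) R) R.

(** Fairness freed of fractions: [a] supplies the color and [b] the row of the cluster. *)
Definition fair_rows (R : seq tree) : bool :=
  all (fun a => all (fun b =>
         count_mem (Node (tfst a) (tsnd b)) R * size R
      == count (fun x => tfst x == tfst a) R * count (fun x => tsnd x == tsnd b) R) R) R.

(* Empty when every color occurs on an edited row; all rows are then editable. *)
Definition ref_colors (R : seq tree) (e : nat) : seq tree :=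
  drop e (undup [seq tfst a | a <- R]).

(** Colored rows are listed without repetition, so that for the right [e] the parameter bounds the
    length of the list and a move can name its source by an index. *)
Definition editable (R : seq tree) (e : nat) : seq tree :=
  undup [seq a <- R | nilp (ref_colors R e)
                      || ~~ proportional R (tfst a) (head Leaf (ref_colors R e))].

Definition row_types (R : seq tree) : seq tree := undup [seq tsnd a | a <- R].

(* The state consists of the remaining bits and of the reversed result: every
   column in which the two rows differ consumes one bit, which tells whether the
   cell is copied from the second row. *)
Definition merge_step (st x : tree) : tree :=
  Node (if tfst x == tsnd x then tfst st else tsnd (tfst st))
       (Node (if (tfst x == tsnd x) || (tfst (tfst st) == Leaf) then tfst x else tsnd x)
             (tsnd st)).

Definition merge_rows (bits w t : tree) : tree :=
  lst (rev (spine (tsnd (foldl merge_step (Node bits Leaf) (tzip (spine w) (spine t)))))).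

Definition dest (types : seq tree) (u desc : tree) : tree :=
  foldl (fun w d => merge_rows (tsnd d) w (nth u types (size (spine (tfst d)))))
        u (spine desc).

(** A move pairs the old colored row with the new one. The color is copied, so no advice can change
    it. *)
Definition move_of (R : seq tree) (e : nat) (m : tree) : tree :=
  let a := nth Leaf (editable R e) (size (spine (tfst m))) in
  Node a (Node (tfst a) (dest (row_types R) (tsnd a) (tsnd m))).

(* The state consists of the move found so far, if any, and of the other moves. *)
Definition take_step (key st m : tree) : tree :=
  if (tfst st == Leaf) && (tfst m == key) then Node m (tsnd st)
  else Node (tfst st) (Node m (tsnd st)).

Definition take_move (key mv : tree) : tree :=
  foldl (take_step key) (Node Leaf Leaf) (spine mv).

Definition apply_step (st a : tree) : tree :=
  Node (tsnd (take_move a (tfst st)))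
       (Node (Node a (if tfst (take_move a (tfst st)) == Leaf then a
                      else tsnd (tfst (take_move a (tfst st)))))
             (tsnd st)).

Definition apply_moves (R mv : seq tree) : seq tree :=
  rev (spine (tsnd (foldl apply_step (Node (lst mv) Leaf) R))).

Definition hamming (s t : seq tree) : nat :=
  count (fun q => tfst q != tsnd q) (tzip s t).

Definition edits (P : seq tree) : nat :=
  sumn [seq hamming (spine (tsnd (tfst p))) (spine (tsnd (tsnd p))) | p <- P].

Definition accepts (K L : nat) (P : seq tree) : bool :=
  [&& fair_rows [seq tsnd p | p <- P], edits P <= K
    & size (row_types [seq tsnd p | p <- P]) <= L].

(** An advice is the unary index of the reference color with a list of moves. Each move is an index
    into [editable] with a list of copy orders, and each order is an index into [row_types] with its
    bits. *)
Definition attempt (R : seq tree) (adv : tree) : seq tree :=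
  apply_moves R [seq move_of R (size (spine (tfst adv))) m | m <- spine (tsnd adv)].

(** This is the shape that [enc_option] gives to a matrix. It is never [Leaf], which is thus free to
    stand for failure and for [None]. *)
Definition answer (P : seq tree) : tree :=
  Node (lst [seq tsnd (tsnd p) | p <- P]) Leaf.

Definition verify (R : seq tree) (K L : nat) (adv : tree) : tree :=
  if accepts K L (attempt R adv) then answer (attempt R adv) else Leaf.

Section AlgorithmFeasible.
Variable B : bound_family.

Lemma feasible_proportional R c c0 :
  feasible_seq B R -> feasible B c -> feasible B c0 ->
  feasible_bool B (fun v => proportional (R v) (c v) (c0 v)).
Proof. by move=> hR hc hc0; rewrite /proportional; feasible_tac. Qed.

Lemma feasible_fair_rows R : feasible_seq B R -> feasible_bool B (fun v => fair_rows (R v)).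
Proof. by move=> hR; rewrite /fair_rows; feasible_tac. Qed.

Lemma feasible_ref_colors R e : feasible_seq B R -> feasible_nat B e ->
  feasible_seq B (fun v => ref_colors (R v) (e v)).
Proof. by move=> hR he; rewrite /ref_colors; feasible_tac. Qed.

Lemma feasible_editable R e : feasible_seq B R -> feasible_nat B e ->
  feasible_seq B (fun v => editable (R v) (e v)).
Proof.
move=> hR he; have hC := feasible_ref_colors hR he.
rewrite /editable; apply: feasible_undup; apply: feasible_filter => //.
apply: feasible_or; last apply: feasible_not.
  by apply: feasible_nilp; apply: (feasible_seq_comp hC); feasible_tac.
apply: feasible_proportional; feasible_tac.
by apply: (feasible_seq_comp hC); feasible_tac.
Qed.

Lemma feasible_row_types R : feasible_seq B R -> feasible_seq B (fun v => row_types (R v)).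
Proof. by move=> hR; rewrite /row_types; feasible_tac. Qed.

(** Every cell of the result comes from one of the two rows, whatever the bits. Hence the
    accumulator of [dest] grows only by the size of the row copied from, as folds require. *)
Lemma merge_rows_size bits w t : tree_size (merge_rows bits w t) <= tree_size w + tree_size t.
Proof.
rewrite /merge_rows tree_size_rev spineK.
rewrite -{2}(spineK w) -{2}(spineK t).
suff gen b acc s1 s2 : tree_size (tsnd (foldl merge_step (Node b acc) (tzip s1 s2)))
    <= tree_size acc + tree_size (lst s1) + tree_size (lst s2) - 2.
  by apply: leq_trans (gen _ _ _ _) _ => /=; lia.
elim: s1 s2 b acc => [|x s1 IH] [|y s2] b acc /=.
- by lia.
- by have := tree_size_gt0 y; lia.
- by have := tree_size_gt0 x; lia.
apply: leq_trans (IH _ _ _) _.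
have := tree_size_gt0 (lst s1); have := tree_size_gt0 (lst s2).
by case: ifP => /= _; lia.
Qed.

Lemma feasible_merge_rows bits w t : feasible B bits -> feasible B w -> feasible B t ->
  feasible B (fun v => merge_rows (bits v) (w v) (t v)).
Proof.
move=> hb hw ht; rewrite /merge_rows.
apply: feasible_lst; apply: feasible_rev; apply: feasible_spine; apply: feasible_snd.
apply: (feasible_foldl0 (step := fun _ => merge_step)); rewrite /merge_step; feasible_tac.
move=> c st x; have := tree_size_snd (tfst st); have := tree_size_fst x; have := tree_size_snd x.
have : tree_size (tfst st) + tree_size (tsnd st) <= (tree_size st).+1 by case: (st) => //= *; lia.
by case: (tfst x == tsnd x) => /=; [|case: ifP => _]; have := tree_size_snd (tfst st); lia.
Qed.

Lemma feasible_dest types u desc : feasible_seq B types -> feasible B u -> feasible B desc ->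
  feasible B (fun v => dest (types v) (u v) (desc v)).
Proof.
move=> ht hu hd; rewrite /dest.
have hn : feasible B (fun p => nth (u (tfst p)) (types (tfst p)) (size (spine (tfst (tsnd p))))).
  by feasible_tac.
apply: (feasible_foldl (step := fun v w d =>
  merge_rows (tsnd d) w (nth (u v) (types v) (size (spine (tfst d)))))); feasible_tac.
  apply: feasible_merge_rows; feasible_tac.
have [a ha] := @feasible_size2 _
  (fun v d => nth (u v) (types v) (size (spine (tfst d)))) hn.
exists a => c x y; apply: leq_trans (merge_rows_size _ _ _) _.
by rewrite leq_add2l; exact: ha.
Qed.

Lemma feasible_move_of R e m : feasible_seq B R -> feasible_nat B e -> feasible B m ->
  feasible B (fun v => move_of (R v) (e v) (m v)).
Proof.
move=> hR he hm; rewrite /move_of.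
have hE := feasible_editable hR he; have hT := feasible_row_types hR.
have ha : feasible B (fun v => nth Leaf (editable (R v) (e v)) (size (spine (tfst (m v))))).
  by feasible_tac.
apply: feasible_node => //; apply: feasible_node; first exact: feasible_fst.
by apply: feasible_dest => //; feasible_tac.
Qed.

Lemma take_move_size key mv : tree_size (take_move key mv) <= tree_size mv + 2.
Proof.
rewrite /take_move -[in leqRHS](spineK mv).
suff gen f r s :
    tree_size (foldl (take_step key) (Node f r) s) <= tree_size f + tree_size r + tree_size (lst s).
  by apply: leq_trans (gen _ _ _) _ => /=; lia.
elim: s f r => [|m s IH] f r /=; first by lia.
rewrite /take_step /=; case: ifP => _; apply: leq_trans (IH _ _) _ => /=; last by lia.
by have := tree_size_gt0 f; lia.
Qed.

Lemma feasible_take_move key mv : feasible B key -> feasible B mv ->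
  feasible B (fun v => take_move (key v) (mv v)).
Proof.
move=> hk hm; rewrite /take_move.
apply: (feasible_foldl0 (step := fun v => take_step (key v))); rewrite /take_step; feasible_tac.
by move=> c [|f r] y /=; case: ifP => _ /=; lia.
Qed.

Lemma feasible_apply_moves R mv : feasible_seq B R -> feasible_seq B mv ->
  feasible_seq B (fun v => apply_moves (R v) (mv v)).
Proof.
move=> hR hm; rewrite /apply_moves; apply: feasible_rev; apply: feasible_spine.
apply: feasible_snd; apply: (feasible_foldl (step := fun _ => apply_step)); feasible_tac.
  have hk : feasible B (fun p => take_move (tfst (tsnd p)) (tfst (tsnd (tsnd p)))).
    by apply: feasible_take_move; feasible_tac.
  by rewrite /apply_step; feasible_tac.
have [a ha] : bounded B (fun n => n + n + 20).
  by apply: bounded_add (bounded_const _ _); apply: bounded_add; exact: bounded_id.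
exists a => c st y.
suff : tree_size (apply_step st y) <= tree_size st + tree_size y + tree_size y + 8.
  by have := ha (tree_size c + tree_size y); have := tree_size_gt0 c; lia.
have := take_move_size y (tfst st); rewrite /apply_step.
have : tree_size (tfst st) + tree_size (tsnd st) <= (tree_size st).+1 by case: (st) => //= *; lia.
case: (take_move _ _) => [|f r] /=; first by lia.
by have := tree_size_snd f; case: ifP => _ /=; lia.
Qed.

Lemma feasible_hamming s t : feasible_seq B s -> feasible_seq B t ->
  feasible_nat B (fun v => hamming (s v) (t v)).
Proof. by move=> hs ht; rewrite /hamming; feasible_tac. Qed.

Lemma feasible_edits P : feasible_seq B P -> feasible_nat B (fun v => edits (P v)).
Proof.
by move=> hP; rewrite /edits; feasible_tac; apply: feasible_hamming; feasible_tac.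
Qed.

Lemma feasible_accepts K L P : feasible_nat B K -> feasible_nat B L -> feasible_seq B P ->
  feasible_bool B (fun v => accepts (K v) (L v) (P v)).
Proof.
move=> hK hL hP; rewrite /accepts; feasible_tac.
- by apply: feasible_fair_rows; feasible_tac.
- exact: feasible_edits.
- by apply: feasible_row_types; feasible_tac.
Qed.

Lemma feasible_attempt R adv : feasible_seq B R -> feasible B adv ->
  feasible_seq B (fun v => attempt (R v) (adv v)).
Proof.
move=> hR ha; apply: feasible_apply_moves => //; feasible_tac.
by apply: feasible_move_of; feasible_tac.
Qed.

Lemma feasible_verify R K L adv :
  feasible_seq B R -> feasible_nat B K -> feasible_nat B L -> feasible B adv ->
  feasible B (fun v => verify (R v) (K v) (L v) (adv v)).
Proof.
move=> hR hK hL ha; have hA := feasible_attempt hR ha.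
rewrite /verify /answer; feasible_tac.
exact: feasible_accepts.
Qed.

End AlgorithmFeasible.

(** * Elementary bounds and the list of advices *)

(** The shift keeps the base at least 2 even for input 0, so that constants and sums are absorbed by
    raising the exponent. *)
Lemma poly_homo a : {homo (fun n => (n + 2) ^ a) : m n / m <= n}.
Proof. by case: a => // a m n le_mn; rewrite leq_exp2r // leq_add2r. Qed.

Lemma poly_id : exists a, forall n, n <= (n + 2) ^ a.
Proof. by exists 1 => n; rewrite expn1 leq_addr. Qed.

Lemma poly_const m : exists a, forall n, m <= (n + 2) ^ a.
Proof.
exists m => n; apply: leq_trans (ltnW (ltn_expl m (isT : 1 < 2))) _.
by case: m => // m; rewrite leq_exp2r // leq_addl.
Qed.

Lemma poly_mul a b : exists c, forall n, (n + 2) ^ a * (n + 2) ^ b <= (n + 2) ^ c.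
Proof. by exists (a + b) => n; rewrite expnD. Qed.

Lemma poly_add a b : exists c, forall n, (n + 2) ^ a + (n + 2) ^ b <= (n + 2) ^ c.
Proof.
exists (a + b).+1 => n; rewrite expnS expnD.
have : 0 < (n + 2) ^ a by rewrite expn_gt0 addnS.
have : 0 < (n + 2) ^ b by rewrite expn_gt0 addnS.
move: ((n + 2) ^ a) ((n + 2) ^ b) => x y; nia.
Qed.

Lemma poly_comp a b : exists c, forall n, ((n + 2) ^ b + 2) ^ a <= (n + 2) ^ c.
Proof.
(* Two more factors, each at least 2, turn [(n + 2) ^ b] into a bound for [(n + 2) ^ b + 2]. *)
exists (b.+2 * a) => n; rewrite expnM.
case: a => // a; rewrite leq_exp2r // !expnS.
have : 0 < (n + 2) ^ b by rewrite expn_gt0 addnS.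
move: ((n + 2) ^ b) => x; nia.
Qed.

Definition poly_family : bound_family :=
  BoundFamily poly_homo poly_id poly_const poly_add poly_mul poly_comp.

Definition exp2 (n : nat) : nat := 2 ^ n.
(** A tower of exponentials whose index is both its height and a shift of the argument; the shift
    makes large indices dominate any constant. *)
Definition elem (a n : nat) : nat := iter a exp2 (n + a).

Lemma leq_exp2 n : n <= exp2 n.
Proof. by apply: ltnW; apply: ltn_expl. Qed.

Lemma exp2_homo : {homo exp2 : m n / m <= n}.
Proof. by move=> m n; rewrite leq_exp2l. Qed.

Lemma iter_exp2_homo a : {homo iter a exp2 : m n / m <= n}.
Proof. by elim: a => // a IH m n /IH /exp2_homo. Qed.

Lemma leq_iter_exp2 a n : n <= iter a exp2 n.
Proof. by elim: a => //= a IH; apply: leq_trans IH (leq_exp2 _). Qed.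

Lemma elem_homo a : {homo elem a : m n / m <= n}.
Proof. by move=> m n le_mn; apply: iter_exp2_homo; rewrite leq_add2r. Qed.

Lemma exp2_elem a n : exp2 (elem a n) <= elem a.+1 n.
Proof. by rewrite /elem /=; apply/exp2_homo/iter_exp2_homo; rewrite leq_add2l. Qed.

Lemma leq_elem a b n : a <= b -> elem a n <= elem b n.
Proof.
elim: b => [|b IH]; first by rewrite leqn0 => /eqP->.
rewrite leq_eqVlt => /orP[/eqP->//|/IH le]; apply: leq_trans le _.
exact: leq_trans (leq_exp2 _) (exp2_elem _ _).
Qed.

Lemma double_leq_exp2 n : n + n <= exp2 n.
Proof.
rewrite /exp2; elim: n => // n IH; rewrite expnS.
have : 0 < 2 ^ n by rewrite expn_gt0.
lia.
Qed.

Lemma elem_id : exists a, forall n, n <= elem a n.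
Proof. by exists 0 => n; rewrite /elem addn0. Qed.

Lemma elem_const m : exists a, forall n, m <= elem a n.
Proof. by exists m => n; apply: leq_trans (leq_iter_exp2 _ _); apply: leq_addl. Qed.

Lemma elem_add a b : exists c, forall n, elem a n + elem b n <= elem c n.
Proof.
exists (maxn a b).+1 => n; apply: leq_trans (exp2_elem _ _).
by apply: leq_trans (double_leq_exp2 _); apply: leq_add; apply: leq_elem; lia.
Qed.

(** With [x] above both values, the power is at most [2 ^ (x * x)], and
    [x * x <= 2 ^ (x + x) <= 2 ^ (2 ^ x)]. This accounts for three more exponentials. *)
Lemma elem_exp a b : exists c, forall n, elem a n ^ elem b n <= elem c n.
Proof.
exists (maxn a b).+3 => n; apply: leq_trans (exp2_elem _ _).
set x := elem (maxn a b) n.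
have le1 : elem a n <= x by apply: leq_elem; lia.
have le2 : elem b n <= x by apply: leq_elem; lia.
apply: (@leq_trans (exp2 x ^ x)).
  apply: (@leq_trans (exp2 x ^ elem b n)); last by rewrite leq_pexp2l // expn_gt0.
  case: (elem b n) => // y; rewrite leq_exp2r //; exact: leq_trans le1 (leq_exp2 _).
rewrite -expnM; apply: exp2_homo; apply: leq_trans (exp2_elem _ _).
apply: leq_trans (exp2_homo (exp2_elem _ _)); rewrite -/x.
apply: (@leq_trans (exp2 x * exp2 x)); first by apply: leq_mul; apply: leq_exp2.
by rewrite -expnD; apply/exp2_homo/double_leq_exp2.
Qed.

Lemma elem_mul a b : exists c, forall n, elem a n * elem b n <= elem c n.
Proof.
exists (maxn a b).+2 => n; apply: leq_trans (exp2_elem _ _).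
apply: leq_trans (exp2_homo (exp2_elem _ _)).
apply: (@leq_trans (exp2 (elem (maxn a b) n) * exp2 (elem (maxn a b) n))).
  by apply: leq_mul; apply: leq_trans (leq_exp2 _); apply: leq_elem; lia.
by rewrite -expnD; apply/exp2_homo/double_leq_exp2.
Qed.

(** In a composition of towers the outer shift sits above the inner tower; this moves it down to the
    argument. *)
Lemma leq_iter_exp2D b m a : iter b exp2 m + a <= iter b exp2 (m + a).
Proof.
elim: b => //= b IH; apply: leq_trans (exp2_homo IH).
rewrite /exp2 expnD; have := ltn_expl a (isT : 1 < 2).
have : 0 < 2 ^ iter b exp2 m by rewrite expn_gt0.
move: (2 ^ a) (2 ^ iter b exp2 m) => x y; nia.
Qed.

Lemma elem_comp a b : exists c, forall n, elem a (elem b n) <= elem c n.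
Proof.
exists (a + b) => n; rewrite /elem iterD; apply: iter_exp2_homo.
by apply: leq_trans (leq_iter_exp2D _ _ _) _; apply: iter_exp2_homo; lia.
Qed.

Definition elem_family : bound_family :=
  BoundFamily elem_homo elem_id elem_const elem_add elem_mul elem_comp.

Lemma bounded_exp b1 b2 : bounded elem_family b1 -> bounded elem_family b2 ->
  bounded elem_family (fun n => b1 n ^ b2 n).
Proof.
move=> [a1 h1] [a2 h2]; have [c hc] := elem_exp a1 a2.
(* The added 1 covers [0 ^ 0], the case in which a power with base 0 is not monotone in its
   exponent. *)
have h : bounded elem_family (fun n => elem a1 n ^ elem a2 n + 1).
  by apply: bounded_add (bounded_const _ _); exists c.
have [d hd] := h; exists d => n; apply: leq_trans (hd n).
case E : (elem a1 n) => [|x].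
  by move: (h1 n); rewrite /= E leqn0 => /eqP ->; case: (b2 n) => [|k]; rewrite ?leq_addl // exp0n.
apply: leq_trans (leq_addr _ _); rewrite -E.
apply: (@leq_trans (elem a1 n ^ b2 n)); last by rewrite leq_pexp2l ?E.
by case: (b2 n) => // k; rewrite leq_exp2r.
Qed.

(** * Binary and unary numbers *)

Lemma enc_natP n :
  (n = 0 /\ enc_nat n = Leaf) \/ exists2 p, n = Pos.to_nat p & enc_nat n = enc_pos p.
Proof.
rewrite /enc_nat; case E : (N.of_nat n) => [|p]; [left|right; exists p => //];
  by rewrite -(Nat2N.id n) E.
Qed.

Lemma size_enc_nat n : tree_size (enc_nat n) <= 4 * n + 4.
Proof.
have [[_ ->] | [p -> ->]] := enc_natP n; first by rewrite addnS.
elim: p => [p IH|p IH|] //; rewrite ?Pos2Nat.inj_xI ?Pos2Nat.inj_xO.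
  have -> : tree_size (enc_pos (xI p)) = tree_size (enc_pos p) + 4 by rewrite /=; lia.
  lia.
have -> : tree_size (enc_pos (xO p)) = tree_size (enc_pos p) + 2 by rewrite /=; lia.
have := Pos2Nat.is_pos p; lia.
Qed.

(** A zero bit is [Leaf], so the binary form of a power of two is its unary exponent followed by a
    one bit. The time bound is chosen as such a power so that it can be output without a conversion
    from unary to binary. *)
Lemma enc_nat_exp2 n : enc_nat (exp2 n) = lst (nseq n Leaf ++ [:: Node Leaf Leaf]).
Proof.
rewrite /enc_nat; suff -> : N.of_nat (exp2 n) = Npos (Pos.shiftl_nat 1 n).
  by elim: n => //= n ->.
elim: n => // n IH; rewrite /exp2 expnS -/(exp2 n).
rewrite (_ : 2 * exp2 n = Nat.mul 2 (exp2 n)) // Nat2N.inj_mul IH.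
reflexivity.
Qed.

Lemma enc_nat_inj : injective enc_nat.
Proof.
have npos p : enc_pos p <> Leaf by case: p.
have inj_pos p q : enc_pos p = enc_pos q -> p = q.
  elim: p q => [p IH|p IH|] [q|q|] //= -[] => [/IH->|/npos|/IH->|/esym/npos] //.
move=> m n; have [[-> ->]|[p -> ->]] := enc_natP m; have [[-> ->]|[q -> ->]] := enc_natP n => //.
- by move/esym/npos.
- by move/npos.
- by move/inj_pos->.
Qed.

(** A Horner step in unary: an encoded bit [y] is itself a unary 0 or 1, so the result is twice [x]
    plus [y]. With [y = Leaf] it is plain doubling. *)
Definition double_add (x y : tree) : tree := lst (spine y ++ spine x ++ spine x).

Definition unary_of_bits (t : tree) : tree := foldl double_add Leaf (rev (spine t)).

Lemma unary_of_bitsE n : unary_of_bits (enc_nat n) = unary n.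
Proof.
rewrite /unary_of_bits; have [[-> ->] // | [p -> ->]] := enc_natP n.
elim: p => [p IH|p IH|] //; rewrite [enc_pos _]/= [spine _]/= rev_cons foldl_rcons IH /double_add lstK /= ?lstK.
  by rewrite Pos2Nat.inj_xI /unary -nseqD /=; congr (Node _ (lst (nseq _ _))); lia.
by rewrite Pos2Nat.inj_xO /unary -nseqD /=; congr (lst (nseq _ _)); lia.
Qed.


(** The accumulator doubles, so the fold with additive growth does not apply; the size is bounded by
    [2 ^ n * n], which is elementary but not polynomial. *)
Lemma feasible_double_add base l :
  feasible elem_family base -> feasible_seq elem_family l ->
  feasible elem_family (fun v => foldl double_add (base v) (l v)).
Proof.
move=> hb hl.
suff h : feasible elem_family (fun v => foldl double_add (base v) (spine (lst (l v)))).
  by move: h; apply: feasible_ext => v; rewrite lstK.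
apply: (feasible_fold_gen (step := fun _ => double_add)) => //.
  by rewrite /double_add; feasible_tac.
have [a ha] : bounded elem_family (fun n => 2 ^ n * n).
  apply: bounded_mul (bounded_id _).
  by apply: bounded_exp; [exact: bounded_const | exact: bounded_id].
exists a => c x s; apply: leq_trans (ha _).
have : tree_size (foldl double_add x s) <= 2 ^ size s * (tree_size x + tree_size (lst s)).
  elim: s x => [|y s IH] x; first by rewrite mul1n /= leq_addr.
  apply: leq_trans (IH _) _.
  have h : tree_size (double_add x y) <= 2 * tree_size x + tree_size y.
    have := tree_size_cat (spine y) (spine x ++ spine x).
    have := tree_size_cat (spine x) (spine x); rewrite !spineK /double_add; lia.
  rewrite /= expnS -mulnA mulnCA leq_mul2l; apply/orP; right; lia.
move/leq_trans; apply; apply: leq_mul; last by lia.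
by rewrite leq_exp2l //; have := size_lst s; lia.
Qed.

Definition unary_exp2 (t : tree) : tree := foldl double_add (unary 1) (spine t).

Lemma unary_exp2E n : unary_exp2 (unary n) = unary (exp2 n).
Proof.
rewrite /unary_exp2 lstK -[exp2 n]muln1; elim: n 1 => [|n IH] m; first by rewrite mul1n.
rewrite /= /double_add /= lstK -nseqD IH; congr unary; rewrite /exp2 expnS; lia.
Qed.

Lemma iter_unary_exp2E a n : iter a unary_exp2 (unary n) = unary (iter a exp2 n).
Proof. by elim: a => //= a ->; rewrite unary_exp2E. Qed.

Lemma feasible_unary_of_bits f :
  feasible elem_family f -> feasible elem_family (fun v => unary_of_bits (f v)).
Proof.
by move=> hf; apply: feasible_double_add; feasible_tac.
Qed.

(** The height [a] of the tower is a constant of the program, so the iteration is a composition of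
    [a] copies of [unary_exp2]. The appended [nseq a Leaf] is the shift in [elem], and the last bit
    turns the unary exponent into a binary power. *)
Lemma computable_exp2_elem a : computable (fun n => exp2 (elem a n)).
Proof.
pose F v := lst (spine (iter a unary_exp2 (lst (spine (unary_of_bits v) ++ nseq a Leaf)))
                 ++ [:: Node Leaf Leaf]).
have [P [T [_ [[_ cP] _ _]]]] : feasible elem_family F.
  have h1 k : feasible elem_family (fun v => iter k unary_exp2 (lst (spine (unary_of_bits v) ++ nseq a Leaf))).
    elim: k => [|b IH] /=.
      apply: feasible_lst; apply: feasible_cat.
        by apply: feasible_spine; apply: feasible_unary_of_bits; exact: feasible_id.
      exact: feasible_const.
    apply: feasible_double_add; last by feasible_tac.
    exact: (feasible_const elem_family 1).
  by have h := h1 a; rewrite /F; feasible_tac.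
exists P => n; have [t et _] := cP (enc_nat n).
exists (1 + t).+1; rewrite enc_nat_exp2.
have -> : lst (nseq (elem a n) Leaf ++ [:: Node Leaf Leaf]) = F (enc_nat n).
  by rewrite /F unary_of_bitsE lstK -nseqD iter_unary_exp2E lstK.
by apply: EvalCall et; apply: (EvalVar _ [:: enc_nat n]).
Qed.

(** * Enumeration of all trees of bounded height *)

Fixpoint height (t : tree) : nat :=
  if t is Node a b then (maxn (height a) (height b)).+1 else 1.

Definition tree_step (x _ : tree) : tree :=
  lst (Leaf :: flatten [seq [seq Node a b | b <- spine x] | a <- spine x]).

(** The list [h] is a counter for the height. The start value is the empty list of trees, as a leaf
    already has height 1. *)
Definition trees (h : seq tree) : tree := foldl tree_step Leaf h.

Lemma mem_trees t h : height t <= size h -> t \in spine (trees h).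
Proof.
elim/last_ind: h t => [|h y IH] t; first by case: t.
rewrite size_rcons /trees foldl_rcons -/(trees h) /tree_step lstK in_cons.
case: t => //= a b; rewrite ltnS geq_max => /andP[/IH ha /IH hb].
apply/flatten_mapP; exists a => //; exact: map_f.
Qed.

(** The strict inequality makes the bound iterate: each step raises the successor of the size to at
    most its fourth power. *)
Lemma tree_step_size x y : tree_size (tree_step x y) < (tree_size x).+1 ^ 4.
Proof.
rewrite /tree_step; set s := spine x.
have h1 a u : tree_size (lst [seq Node a b | b <- u])
    <= tree_size (lst u) + size u * (tree_size a).+1.
  by elim: u => //= z u IH; lia.
have h2 u : tree_size (lst (flatten [seq [seq Node a b | b <- s] | a <- u]))
    <= 1 + size u * tree_size (lst s) + size s * tree_size (lst u).
  elim: u => [|z u IH] //=.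
  have := tree_size_cat [seq Node z b | b <- s] (flatten [seq [seq Node a b | b <- s] | a <- u]).
  have := h1 z s; move: IH; nia.
have := h2 s; have := size_lst s; rewrite spineK !expnS /= => le1 le2.
have := tree_size_gt0 x; nia.
Qed.

Lemma feasible_trees l : feasible_seq elem_family l ->
  feasible elem_family (fun v => trees (l v)).
Proof.
move=> hl.
suff h : feasible elem_family (fun v => foldl tree_step Leaf (spine (lst (l v)))).
  by move: h; apply: feasible_ext => v; rewrite lstK.
apply: (feasible_fold_gen (step := fun _ => tree_step)) => //; last first.
- have [a ha] : bounded elem_family (fun n => (n.+1) ^ (4 ^ n)).
    apply: bounded_exp; first by apply: bounded_succ; exact: bounded_id.
    by apply: bounded_exp; [exact: bounded_const | exact: bounded_id].
  exists a => c x s; apply: leq_trans (ha _).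
  have : tree_size (foldl tree_step x s) < (tree_size x).+1 ^ (4 ^ size s).
    elim: s x => [|y s IH] x; first by rewrite /= expn1.
    apply: leq_trans (IH _) _; rewrite /= expnS expnM leq_exp2r ?expn_gt0 //.
    exact: tree_step_size.
  move/ltnW/leq_trans; apply.
  apply: (@leq_trans ((tree_size c + tree_size x + tree_size (lst s)).+1 ^ 4 ^ size s)).
    by rewrite leq_exp2r ?expn_gt0 //; lia.
  by rewrite leq_exp2l ?leq_exp2l //; have := size_lst s; have := tree_size_gt0 x; lia.
- exact: feasible_leaf.
rewrite /tree_step; feasible_tac.
apply: feasible_flatten; feasible_tac.
Qed.

(** * Moves and merges of rows *)

(** [Leaf] marks that nothing has been found. A move starting at a key that is not a leaf is a node,
    so it cannot be mistaken for this mark. The other moves come back in reverse, hence the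
    permutations. *)
Lemma take_moveP key mv : key != Leaf ->
  (exists2 r, take_move key (lst mv) = Node Leaf (lst r)
     & perm_eq r mv /\ key \notin [seq tfst m | m <- mv])
  \/ (exists b r, take_move key (lst mv) = Node (Node key b) (lst r)
     /\ perm_eq (Node key b :: r) mv).
Proof.
move=> key0; rewrite /take_move lstK.
have found f r s : f != Leaf ->
    foldl (take_step key) (Node f (lst r)) s = Node f (lst (catrev s r)).
  by elim: s r => //= x s IH r /[dup] f0 /negbTE; rewrite /take_step /= => ->; exact: (IH (x :: r)).
suff gen r s :
  (exists2 r', foldl (take_step key) (Node Leaf (lst r)) s = Node Leaf (lst r')
     & perm_eq r' (catrev s r) /\ key \notin [seq tfst m | m <- s])
  \/ (exists b r', foldl (take_step key) (Node Leaf (lst r)) s = Node (Node key b) (lst r')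
     /\ perm_eq (Node key b :: r') (catrev s r)).
  have rs : perm_eq (catrev mv [::]) mv by rewrite perm_rev.
  case: (gen [::] mv) => [[r e [p k]]|[b [r [e p]]]]; [left|right].
    by exists r => //; split=> //; apply: perm_trans p rs.
  by exists b, r; split=> //; apply: perm_trans p rs.
elim: s r => [|x s IH] r /=; first by left; exists r.
rewrite /take_step /=; case: eqP => [xk|xk].
  case: x xk => [/= k0|_ b /= ->]; first by rewrite -k0 eqxx in key0.
  right; exists b, (catrev s r); rewrite found //; split=> //.
  by rewrite !catrevE -[in X in perm_eq _ X]cat_rcons -cats1 -catA perm_sym perm_catCA.
case: (IH (x :: r)) => [[r' e [p k]]|[b [r' [e p]]]]; [left|right].
  by exists r' => //; split=> //; rewrite in_cons negb_or k andbT; apply/eqP => /esym.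
by exists b, r'.
Qed.

Lemma apply_moves_cons a R mv :
  apply_moves (a :: R) mv =
  Node a (if tfst (take_move a (lst mv)) == Leaf then a else tsnd (tfst (take_move a (lst mv))))
  :: apply_moves R (spine (tsnd (take_move a (lst mv)))).
Proof.
rewrite /apply_moves /=.
have gen M acc s : spine (tsnd (foldl apply_step (Node M (lst acc)) s))
    = spine (tsnd (foldl apply_step (Node M Leaf) s)) ++ acc.
  elim: s M acc => [|x s IH] M acc /=; first by rewrite lstK.
  rewrite /apply_step /=; set M' := tsnd (take_move _ _); set y := Node x _.
  by rewrite (IH M' (y :: acc)) (IH M' [:: y]) -catA.
set y := Node a _.
by rewrite /apply_step /= -/y (gen _ [:: y]) rev_cat spineK.
Qed.

(** For soundness: nothing is assumed of the moves, so this also covers meaningless advice. *)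
Lemma apply_moves_pointwise (T : eqType) (r : T -> tree) (s : seq T) mv :
  uniq s -> {in s, forall i, r i != Leaf} ->
  exists b : T -> tree, apply_moves [seq r i | i <- s] mv = [seq Node (r i) (b i) | i <- s]
    /\ {in s, forall i, b i = r i \/ Node (r i) (b i) \in mv}.
Proof.
elim: s mv => [|x s IH] mv /=; first by exists r.
move=> /andP[xs us] r0; rewrite apply_moves_cons.
have rx : r x != Leaf by apply: r0; exact: mem_head.
set tk := take_move _ _; pose bx := if tfst tk == Leaf then r x else tsnd (tfst tk).
have [hx hmv] : (bx = r x \/ Node (r x) bx \in mv) /\ {subset spine (tsnd tk) <= mv}.
  rewrite /bx /tk; case: (take_moveP mv rx) => [[r' -> [p _]]|[b [r' [-> p]]]] /=; rewrite lstK.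
    by split; [left | move=> z; rewrite (perm_mem p)].
  split; first by right; rewrite -(perm_mem p) mem_head.
  by move=> z zr; rewrite -(perm_mem p) in_cons zr orbT.
have [|b [eb hb]] := IH (spine (tsnd tk)) us.
  by move=> i si; apply: r0; rewrite in_cons si orbT.
exists (fun i => if i == x then bx else b i); split.
  rewrite eb eqxx -/bx; congr (_ :: _); apply/eq_in_map => i si.
  by case: eqP => // ix; rewrite -ix si in xs.
move=> i; rewrite in_cons; case: eqP => [-> _|_ /= /hb [->|/hmv]]; by [| left | right].
Qed.

(** For completeness: if the sources of the moves and the untouched rows [U] make up [R], every move
    gets used. Which of several identical rows receives a move is left open, so only the multiset of
    pairs is determined. *)
Lemma apply_moves_perm (R mv U : seq tree) :
  {in R, forall a, a != Leaf} ->
  {in mv, forall m, m = Node (tfst m) (tsnd m)} ->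
  perm_eq ([seq tfst m | m <- mv] ++ U) R ->
  perm_eq (apply_moves R mv) (mv ++ [seq Node a a | a <- U]).
Proof.
elim: R mv U => [|a R IH] mv U R0 mvN.
  by move/perm_size/eqP; rewrite size_cat size_map addn_eq0 !size_eq0 => /andP[/eqP-> /eqP->].
move=> pR; rewrite apply_moves_cons.
have a0 : a != Leaf by apply: R0; exact: mem_head.
have R0' : {in R, forall x, x != Leaf} by move=> x xR; apply: R0; rewrite in_cons xR orbT.
case: (take_moveP mv a0) => [[r -> [p ka]]|[b [r [-> p]]]] /=; rewrite lstK.
  have aU : a \in U.
    by have := mem_head a R; rewrite -(perm_mem pR) mem_cat (negbTE ka).
  have pU := perm_to_rem aU.
  have pr : perm_eq ([seq tfst m | m <- r] ++ rem a U) R.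
    rewrite -(perm_cons a); apply: perm_trans pR.
    rewrite -cat1s perm_sym; apply: (@perm_trans _ ([seq tfst m | m <- mv] ++ a :: rem a U)).
      by rewrite perm_cat2l.
    by rewrite perm_catC /= perm_cons perm_catC perm_cat2r perm_sym; apply: perm_map.
  have mvr : {in r, forall m, m = Node (tfst m) (tsnd m)}.
    by move=> m; rewrite (perm_mem p); exact: mvN.
  have := IH _ _ R0' mvr pr; rewrite -(perm_cons (Node a a)) => /perm_trans; apply.
  rewrite perm_sym; apply: (@perm_trans _ (mv ++ [seq Node x x | x <- a :: rem a U])).
    by rewrite perm_cat2l; apply: perm_map.
  by rewrite /= perm_catC /= perm_cons perm_catC perm_cat2r perm_sym.
have pr : perm_eq ([seq tfst m | m <- r] ++ U) R.
  rewrite -(perm_cons a); apply: perm_trans pR.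
  by rewrite -cat_cons perm_cat2r; exact: (perm_map tfst p).
have mvr : {in r, forall m, m = Node (tfst m) (tsnd m)}.
  by move=> m mr; apply: mvN; rewrite -(perm_mem p) in_cons mr orbT.
have := IH _ _ R0' mvr pr; rewrite -(perm_cons (Node a b)) => /perm_trans; apply.
by rewrite -cat_cons perm_cat2r.
Qed.

Lemma fair_rowsP R : reflect
  (forall c w, count_mem (Node c w) R * size R
     = count (fun x => tfst x == c) R * count (fun x => tsnd x == w) R)
  (fair_rows R).
Proof.
apply: (iffP idP) => [/allP fR c w|fR]; last first.
  by apply/allP => a _; apply/allP => b _; rewrite fR.
have le1 : count_mem (Node c w) R <= count (fun x => tfst x == c) R.
  by apply: sub_count => x /eqP->; rewrite /= eqxx.
have le2 : count_mem (Node c w) R <= count (fun x => tsnd x == w) R.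
  by apply: sub_count => x /eqP->; rewrite /= eqxx.
have [/hasP[a aR /eqP ac]|] := boolP (has (fun x => tfst x == c) R); last first.
  by rewrite has_count -leqNgt leqn0 => /eqP c0; move: le1; rewrite c0 leqn0 => /eqP->.
have [/hasP[b bR /eqP bw]|] := boolP (has (fun x => tsnd x == w) R); last first.
  by rewrite has_count -leqNgt leqn0 => /eqP c0; move: le2; rewrite c0 leqn0 muln0 => /eqP->.
by have /allP/(_ b bR)/eqP := fR a aR; rewrite ac bw.
Qed.

Lemma fair_rows_perm R1 R2 : perm_eq R1 R2 -> fair_rows R1 = fair_rows R2.
Proof.
move=> p; apply/fair_rowsP/fair_rowsP => h c w.
  by rewrite -!(permP p) -(perm_size p).
by rewrite !(permP p) (perm_size p).
Qed.

Lemma size_row_types_perm R1 R2 :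
  perm_eq R1 R2 -> size (row_types R1) = size (row_types R2).
Proof.
move=> p; apply: perm_size; apply: uniq_perm; rewrite ?undup_uniq // => x.
by rewrite !mem_undup; apply: perm_mem; apply: perm_map.
Qed.

Lemma edits_perm P1 P2 : perm_eq P1 P2 -> edits P1 = edits P2.
Proof. by move=> p; apply: perm_sumn; apply: perm_map. Qed.

Lemma accepts_perm K L P1 P2 : perm_eq P1 P2 -> accepts K L P1 = accepts K L P2.
Proof.
move=> p; rewrite /accepts (edits_perm p).
have pm := perm_map tsnd p.
by rewrite (fair_rows_perm pm) (size_row_types_perm pm).
Qed.

Lemma hammingE n s t : size s = n -> size t = n ->
  hamming s t = \sum_(j < n) (nth Leaf s j != nth Leaf t j).
Proof.
elim: n s t => [|n IH] [|x s] [|y t] //=; first by rewrite big_ord0.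
by move=> [ss] [st]; rewrite big_ord_recl /= -IH.
Qed.

Lemma hamming_le n s t s' t' : size s = n -> size t = n -> size s' = n -> size t' = n ->
  (forall j, j < n -> nth Leaf s j = nth Leaf t j -> nth Leaf s' j = nth Leaf t' j) ->
  hamming s' t' <= hamming s t.
Proof.
move=> ss st ss' st' h; rewrite (hammingE ss st) (hammingE ss' st'); apply: leq_sum => j _.
by case: eqP => [_|ne]; case: eqP => // e; case: ne; apply: h.
Qed.

Lemma hamming_triangle n s t u : size s = n -> size t = n -> size u = n ->
  hamming s t <= hamming s u + hamming t u.
Proof.
move=> ss st su; rewrite (hammingE ss st) (hammingE ss su) (hammingE st su) -big_split.
apply: leq_sum => j _ /=; case: eqP => //; case: eqP => //; case: eqP => // -> -> //.
Qed.

Lemma hamming_gt0 s t : size s = size t -> s != t -> 0 < hamming s t.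
Proof.
elim: s t => [|x s IH] [|y t] //.
move=> /= [/IH h]; rewrite eqseq_cons /hamming /=.
by case: (x == y) => //= /h.
Qed.

Fixpoint merge (bits : tree) (s t : seq tree) : seq tree :=
  match s, t with
  | x :: s', y :: t' =>
      (if (x == y) || (tfst bits == Leaf) then x else y)
      :: merge (if x == y then bits else tsnd bits) s' t'
  | _, _ => [::]
  end.

Lemma merge_rowsE bits w t : merge_rows bits w t = lst (merge bits (spine w) (spine t)).
Proof.
rewrite /merge_rows; congr lst.
suff gen b acc s1 s2 : rev (spine (tsnd (foldl merge_step (Node b (lst acc)) (tzip s1 s2))))
    = rev acc ++ merge b s1 s2.
  by rewrite (gen _ [::]).
elim: s1 s2 b acc => [|x s1 IH] [|y s2] b acc; rewrite /= ?lstK ?cats0 //.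
by rewrite /merge_step /= (IH _ _ (_ :: acc)) rev_cons cat_rcons.
Qed.

Lemma size_merge bits s t : size s = size t -> size (merge bits s t) = size s.
Proof. by elim: s t bits => [|x s IH] [|y t] bits //= e; congr _.+1; apply: IH; case: e. Qed.

Lemma nth_merge bits s t j : size s = size t ->
  nth Leaf (merge bits s t) j = nth Leaf s j \/ nth Leaf (merge bits s t) j = nth Leaf t j.
Proof.
elim: s t bits j => [|x s IH] [|y t] bits [|j] //= st; try by left.
  by case: ifP; [left | right].
by apply: IH; case: st.
Qed.

(** The bit for a column where [s] and [t] differ says whether [t] already has the target value
    there. Columns where they agree need no bit, as copying would change nothing. *)
Lemma merge_towards (s t w : seq tree) : size s = size w -> size t = size w ->
  exists2 bits : seq bool, size bits = hamming s t &
    forall j, j < size w -> nth Leaf (merge (lst (map enc_bool bits)) s t) j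
      = if nth Leaf t j == nth Leaf w j then nth Leaf w j else nth Leaf s j.
Proof.
elim: w s t => [|z w IH] [|x s] [|y t] //; first by exists [::].
move=> /= [ss] [st]; have [bits sb hb] := IH s t ss st.
rewrite /hamming /= -/(hamming s t); case: (eqVneq x y) => [->|xy].
  exists bits => // -[_|j] /=; last exact: hb.
  by case: eqP.
exists ((y == z) :: bits); first by rewrite /= sb.
move=> [_|j] /=; last exact: hb.
by case: (eqVneq y z) => [->|].
Qed.

(** * Completeness of the advice *)

Section Rows.
Variables (m : nat) (col : 'I_m -> tree).

Definition rows (w : 'I_m -> tree) : seq tree := [seq Node (col i) (w i) | i <- enum 'I_m].

Lemma row_typesE w : row_types (rows w) = undup [seq w i | i <- enum 'I_m].
Proof. by rewrite /row_types -map_comp. Qed.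

Definition cell_count (w : 'I_m -> tree) (c a : tree) : nat :=
  \sum_i (col i == c) && (w i == a).
Definition color_count (c : tree) : nat := \sum_i (col i == c).
Definition row_count (w : 'I_m -> tree) (a : tree) : nat := \sum_i (w i == a).

Lemma count_enum (p : pred 'I_m) : count p (enum 'I_m) = \sum_i p i.
Proof. by rewrite -sumn_count sumnE big_map big_enum. Qed.

Lemma count_rows w c a : count_mem (Node c a) (rows w) = cell_count w c a.
Proof. by rewrite count_map count_enum. Qed.

Lemma count_rows_fst w c : count (fun x => tfst x == c) (rows w) = color_count c.
Proof. by rewrite count_map count_enum. Qed.

Lemma count_rows_snd w a : count (fun x => tsnd x == a) (rows w) = row_count w a.
Proof. by rewrite count_map count_enum. Qed.

Definition fair_map (w : 'I_m -> tree) : Prop :=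
  forall c a, cell_count w c a * m = color_count c * row_count w a.

Lemma fair_rowsE w : fair_rows (rows w) <-> fair_map w.
Proof.
have sR : size (rows w) = m by rewrite size_map size_enum_ord.
split=> [/fair_rowsP h c a|h].
  by rewrite -(count_rows w) -(count_rows_fst w) -(count_rows_snd w) -{1}sR h.
by apply/fair_rowsP => c a; rewrite count_rows count_rows_fst count_rows_snd sR.
Qed.

Lemma proportionalE w c c0 : proportional (rows w) c c0 <->
  (forall a, cell_count w c a * color_count c0 = cell_count w c0 a * color_count c).
Proof.
rewrite /proportional; split=> [/allP h a|h]; last first.
  by apply/allP => a _; rewrite !count_rows !count_rows_fst h.
have [/existsP[i /eqP wi]|/existsPn wa] := boolP [exists i, w i == a].
  have := h (Node (col i) (w i)) (map_f _ (mem_enum _ i)).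
  by rewrite !count_rows !count_rows_fst /= wi => /eqP.
have h0 c' : cell_count w c' a = 0.
  by apply: big1 => i _; rewrite (negbTE (wa i)) andbF.
by rewrite !h0.
Qed.

Lemma rows_perm w w' : (forall c a, cell_count w c a = cell_count w' c a) ->
  perm_eq (rows w) (rows w').
Proof.
move=> h; apply/allP => x; rewrite mem_cat => xin /=.
have [c [a ->]] : exists c a, x = Node c a.
  by case/orP: xin => /mapP[i _ ->]; exists (col i); eexists.
by rewrite !count_rows h.
Qed.

(** The counts for a new row [b] are sums over the old rows [a] with [phi a = b], so the fairness
    identities of these [a] add up to that of [b]. *)
Lemma fair_map_comp w (phi : tree -> tree) : fair_map w -> fair_map (phi \o w).
Proof.
move=> fw c b.
have decomp (p : 'I_m -> bool) : \sum_i (p i && (phi (w i) == b) : nat)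
    = \sum_(a <- undup [seq w i | i <- enum 'I_m] | phi a == b) \sum_i (p i && (w i == a)).
  rewrite exchange_big; apply: eq_bigr => i _ /=.
  have wi : w i \in undup [seq w i | i <- enum 'I_m].
    by rewrite mem_undup; apply: map_f; rewrite mem_enum.
  rewrite (big_mkcond (fun a => phi a == b)) (bigD1_seq (w i)) ?undup_uniq //= eqxx andbT.
  rewrite big1 => [|a ne]; last by rewrite (eq_sym (w i)) (negbTE ne) andbF; case: ifP.
  by rewrite addn0; case: (phi (w i) == b); rewrite ?andbT ?andbF.
have := decomp xpredT; have := decomp (fun i => col i == c).
rewrite /cell_count /row_count /= => -> ->.
rewrite big_distrl big_distrr /=; apply: eq_bigr => a _; exact: fw.
Qed.

End Rows.

Lemma size_undup_map (T1 T2 : eqType) (f : T1 -> T2) (s : seq T1) :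
  size (undup (map f s)) <= size (undup s).
Proof.
rewrite -(size_map f (undup s)); apply: uniq_leq_size; first exact: undup_uniq.
by move=> x; rewrite mem_undup => /mapP[y ys ->]; apply: map_f; rewrite mem_undup.
Qed.

Lemma height_lst H s : 0 < H -> {in s, forall x, height x <= H} -> height (lst s) <= size s + H.
Proof.
move=> H0; elim: s => [|x s IH] //= h.
rewrite addSn ltnS geq_max; apply/andP; split.
  by apply: leq_trans (h x (mem_head _ _)) (leq_addl _ _).
by apply: IH => y ys; apply: h; rewrite in_cons ys orbT.
Qed.

Lemma height_unary n : height (unary n) <= n.+1.
Proof.
by have := @height_lst 1 (nseq n Leaf) isT; rewrite size_nseq addn1; apply=> x /nseqP[->].
Qed.

Lemma seq_witnesses (S T : eqType) (P : S -> T -> Prop) (s : seq S) :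
  {in s, forall j, exists t, P j t} ->
  exists ts, [/\ size ts = size s, {in ts, forall t, exists2 j, j \in s & P j t}
    & {in s, forall j, exists2 t, t \in ts & P j t}].
Proof.
elim: s => [|x s IH] h; first by exists [::].
have [|ts [sts h1 h2]] := IH; first by move=> j js; apply: h; rewrite in_cons js orbT.
have [t Pt] := h x (mem_head _ _).
exists (t :: ts); split=> [|y|j]; first by rewrite /= sts.
  rewrite in_cons => /orP[/eqP->|/h1[j js Pj]]; first by exists x; rewrite ?mem_head.
  by exists j; rewrite // in_cons js orbT.
rewrite in_cons => /orP[/eqP->|/h2[y yt Py]]; first by exists t; rewrite ?mem_head.
by exists y; rewrite // in_cons yt orbT.
Qed.

Section Completeness.
Variables (m n : nat) (col mu : 'I_m -> tree) (K L : nat).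
Hypothesis mu_size : forall i, size (spine (mu i)) = n.

Let R := rows col mu.
Let types := row_types R.

Lemma mem_types i : mu i \in types.
Proof.
rewrite mem_undup -map_comp; apply/mapP; exists i; rewrite ?mem_enum //.
Qed.

Definition cost (w : 'I_m -> tree) : nat := \sum_i hamming (spine (mu i)) (spine (w i)).

Definition changes (w : 'I_m -> tree) : seq tree :=
  [seq Node (Node (col i) (mu i)) (Node (col i) (w i)) | i <- enum 'I_m].

Lemma edits_changes w : edits (changes w) = cost w.
Proof. by rewrite /edits -map_comp sumnE big_map big_enum. Qed.

Lemma changes_snd w : [seq tsnd p | p <- changes w] = rows col w.
Proof. by rewrite -map_comp. Qed.

Definition edited (w : 'I_m -> tree) : seq 'I_m := [seq i <- enum 'I_m | w i != mu i].

Lemma mem_edited w i : (i \in edited w) = (w i != mu i).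
Proof. by rewrite mem_filter mem_enum andbT. Qed.

Lemma size_edited w : (forall i, size (spine (w i)) = n) -> size (edited w) <= cost w.
Proof.
move=> sw; rewrite size_filter count_enum; apply: leq_sum => i _.
case: eqP => //= /eqP ne; apply: hamming_gt0; first by rewrite sw mu_size.
by apply: contra ne => /eqP /(congr1 lst); rewrite !spineK => ->.
Qed.

Section Merges.
Variables (u w : tree).
Hypothesis w_size : size (spine w) = n.

Definition dest_step (x d : tree) : tree :=
  merge_rows (tsnd d) x (nth u types (size (spine (tfst d)))).

(** Copying from the rows of [ts] in turn, and only cells that agree with [w], never increases the
    distance to [w]. The bound on the sum of distances therefore persists, and by the triangle
    inequality each merge needs at most [K] bits. *)
Lemma merges_reach (ts : seq tree) (x : tree) :
  size (spine x) = n ->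
  {in ts, forall t, [/\ t \in types, size (spine t) = n
      & hamming (spine x) (spine w) + hamming (spine t) (spine w) <= K]} ->
  (forall j, j < n -> nth Leaf (spine x) j = nth Leaf (spine w) j \/
     exists2 t, t \in ts & nth Leaf (spine t) j = nth Leaf (spine w) j) ->
  exists ds, [/\ size ds = size ts, foldl dest_step x ds = w
    & {in ds, forall d, height d <= K + size types + 3}].
Proof.
elim: ts x => [|t ts IH] x sx ht hc.
  exists [::]; split=> //=; rewrite -[x]spineK -[w]spineK; congr lst.
  apply: (@eq_from_nth _ Leaf); first by rewrite sx w_size.
  by rewrite sx => j /hc[->|[]].
have [tt st htw] := ht t (mem_head _ _).
have [|| bits sb hb] := @merge_towards (spine x) (spine t) (spine w); rewrite ?w_size //.
pose d := Node (unary (index t types)) (lst (map enc_bool bits)).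
have dE : dest_step x d = lst (merge (lst (map enc_bool bits)) (spine x) (spine t)).
  by rewrite /dest_step /d /= size_spine_unary nth_index // merge_rowsE.
have sx' : size (spine (dest_step x d)) = n by rewrite dE lstK size_merge ?sx ?st.
have hx' j : j < n -> nth Leaf (spine (dest_step x d)) j =
    if nth Leaf (spine t) j == nth Leaf (spine w) j then nth Leaf (spine w) j
    else nth Leaf (spine x) j.
  by rewrite dE lstK => jn; rewrite hb ?w_size.
have hle : hamming (spine (dest_step x d)) (spine w) <= hamming (spine x) (spine w).
  by apply: (@hamming_le n) => // j jn e; rewrite hx' //; case: ifP.
have [|j jn|ds [sds eds hds]] := IH _ sx'.
- move=> t' ts'; have [|h1 h2 h3] := ht t'; first by rewrite in_cons ts' orbT.
  by split=> //; apply: leq_trans h3; rewrite leq_add2r.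
- rewrite hx' //; case: ifP => [|ne]; first by left.
  have [->|[t']] := hc j jn; first by left.
  rewrite in_cons => /orP[/eqP-> e|]; first by rewrite e eqxx in ne.
  by right; exists t'.
exists (d :: ds); split; rewrite /= ?sds //.
move=> d'; rewrite in_cons => /orP[/eqP->|/hds //]; rewrite /d /=.
have h1 := height_unary (index t types).
have h2 : index t types < size types by rewrite index_mem.
have h3 : height (lst (map enc_bool bits)) <= size (map enc_bool bits) + 2.
  by apply: height_lst => // y /mapP[[] _ ->].
have h4 : hamming (spine x) (spine t) <= K.
  by apply: leq_trans (hamming_triangle sx st w_size) htw.
move: h3; rewrite size_map sb; lia.
Qed.

End Merges.

Section Solution.
Variable w1 : 'I_m -> tree.
Hypothesis w1_size : forall i, size (spine (w1 i)) = n.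
Hypothesis w1_fair : fair_map col w1.
Hypothesis w1_cost : cost w1 <= K.
Hypothesis w1_types : size (row_types (rows col w1)) <= L.

Let colors := undup [seq tfst a | a <- R].
Let edited_colors := [seq col i | i <- edited w1].
(** Position of the first color without edited rows. If there is none, [e] is the number of colors
    and [ref_colors] is empty. *)
Let e := find (fun c => c \notin edited_colors) colors.

(** It refers to the solution only through [e]. Once the advice supplies [e], the program can
    evaluate the condition on the input. *)
Definition frozen (c : tree) : bool :=
  ~~ nilp (ref_colors R e) && proportional R c (head Leaf (ref_colors R e)).

Lemma size_edited_colors : size edited_colors <= K.
Proof. by rewrite size_map; apply: leq_trans (size_edited w1_size) w1_cost. Qed.

Lemma size_types : size types <= K + L.
Proof.
apply: (@leq_trans (size ([seq mu i | i <- edited w1] ++ row_types (rows col w1)))).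
  apply: uniq_leq_size; first exact: undup_uniq.
  move=> t; rewrite mem_undup -map_comp => /mapP[i _ /= ->].
  rewrite mem_cat mem_undup -map_comp; have [wi|wi] := eqVneq (w1 i) (mu i).
    by apply/orP; right; apply/mapP; exists i; rewrite ?mem_enum /= ?wi.
  by apply/orP; left; apply: map_f; rewrite mem_edited.
rewrite size_cat size_map leq_add // ?w1_types //.
exact: leq_trans (size_edited w1_size) w1_cost.
Qed.

(** The colors listed before position [e] are distinct and each occurs on an edited row, of which
    there are at most [K]. *)
Lemma ref_index_le : e <= K.
Proof.
apply: leq_trans size_edited_colors.
have <- : size (take e colors) = e by rewrite size_takel // find_size.
apply: uniq_leq_size; first by rewrite take_uniq // undup_uniq.
move=> c /(nthP Leaf)[j]; rewrite size_takel ?find_size // => je <-.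
rewrite nth_take //; have := before_find Leaf je; by move/negbFE.
Qed.

Lemma mem_colors i : col i \in colors.
Proof. by rewrite mem_undup -map_comp; apply/mapP; exists i; rewrite ?mem_enum. Qed.

Lemma unedited_cell_count c a :
  c \notin edited_colors -> cell_count col w1 c a = cell_count col mu c a.
Proof.
move=> cn; apply: eq_bigr => i _; case: eqP => //= ci.
suff -> : w1 i = mu i by [].
by apply/eqP; apply: contraNT cn => ne; rewrite -ci; apply: map_f; rewrite mem_edited.
Qed.

Lemma color_count_gt0 i : 0 < color_count col (col i).
Proof. by rewrite /color_count (bigD1 i) //= eqxx. Qed.

Lemma ref_color : ~~ nilp (ref_colors R e) ->
  head Leaf (ref_colors R e) \notin edited_colors /\
  exists i, head Leaf (ref_colors R e) = col i.
Proof.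
rewrite /nilp /ref_colors size_drop subn_eq0 -ltnNge => lt_e.
rewrite -nth0 nth_drop addn0; split.
  by have := @nth_find _ Leaf (fun c => c \notin edited_colors) colors; rewrite has_find; apply.
have := mem_nth Leaf lt_e; rewrite mem_undup -map_comp => /mapP[i _ ->].
by exists i.
Qed.

(** Neither this color nor the reference color is edited, so their proportionality in the fair [w1]
    already holds in the input. The contrapositive limits the editable colors. *)
Lemma unedited_frozen i : col i \notin edited_colors -> frozen (col i).
Proof.
move=> cn; have nn : ~~ nilp (ref_colors R e).
  rewrite /nilp /ref_colors size_drop subn_eq0 -ltnNge -has_find.
  by apply/hasP; exists (col i) => //; exact: mem_colors.
have [hn [i0 hi0]] := ref_color nn.
rewrite /frozen nn; apply/proportionalE => a; rewrite -!unedited_cell_count //.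
have m0 : 0 < m by apply: leq_ltn_trans (ltn_ord i).
apply/eqP; rewrite -(eqn_pmul2r m0) mulnAC w1_fair [X in _ == X]mulnAC w1_fair.
by apply/eqP; lia.
Qed.

(** The input distributes the color in proportion to the reference color because it is frozen, and
    [w1] does so by fairness. The reference color is unedited and nonempty, so the two counts
    agree. *)
Lemma frozen_cell_count i a :
  frozen (col i) -> cell_count col mu (col i) a = cell_count col w1 (col i) a.
Proof.
case/andP=> /ref_color [hn [i0 hi0]] /proportionalE /(_ a).
rewrite -(unedited_cell_count a hn) hi0 => h.
have m0 : 0 < m by apply: leq_ltn_trans (ltn_ord i).
have h1 := w1_fair (col i) a; have h2 := w1_fair (col i0) a.
have c0 := color_count_gt0 i0.
apply/eqP; rewrite -(eqn_pmul2r m0) -(eqn_pmul2r c0) h1; apply/eqP.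
rewrite mulnAC h mulnAC h2; lia.
Qed.

Lemma mem_editable i : ~~ frozen (col i) -> Node (col i) (mu i) \in editable R e.
Proof.
rewrite /frozen negb_and negbK => fi; rewrite mem_undup mem_filter fi /=.
by apply: map_f; rewrite mem_enum.
Qed.

(** An editable pair combines the color of some edited row with one of the input row types. *)
Lemma size_editable : size (editable R e) <= K * (K + L).
Proof.
apply: (@leq_trans (size [seq Node c t | c <- edited_colors, t <- types])); last first.
  by rewrite size_allpairs leq_mul // ?size_edited_colors // size_types.
apply: uniq_leq_size; first exact: undup_uniq.
move=> x; rewrite mem_undup mem_filter => /andP[fx /mapP[i _ xi]].
rewrite xi; apply: allpairs_f; last exact: mem_types.
apply: contraLR fx => /unedited_frozen; rewrite /frozen xi /=.
by rewrite negb_or negbK.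
Qed.

Let w2 (i : 'I_m) : tree := if frozen (col i) then mu i else w1 i.

Lemma w2_size i : size (spine (w2 i)) = n.
Proof. by rewrite /w2; case: ifP. Qed.

Lemma w2_perm : perm_eq (rows col w2) (rows col w1).
Proof.
apply: rows_perm => c a; have [[i /eqP ci]|] := altP (@existsP _ (fun i => col i == c)).
  rewrite -ci; case fi : (frozen (col i)).
    rewrite -(frozen_cell_count a fi); apply: eq_bigr => j _.
    by case: eqP => //= cj; rewrite /w2 cj fi.
  by apply: eq_bigr => j _; case: eqP => //= cj; rewrite /w2 cj fi.
move/existsPn => nc; rewrite /cell_count !big1 // => i _; by rewrite (negbTE (nc i)).
Qed.

(* Some row of the same new cluster holds the new value of a cell, so that it
   can be copied; a value occurring nowhere in its cluster costs one edit per
   row, and is replaced by a value of the cluster. *)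
Lemma normalized : exists phi : tree -> tree, forall i,
  [/\ size (spine (phi (w2 i))) = n,
      forall j, j < n -> exists2 i', w2 i' = w2 i
        & nth Leaf (spine (mu i')) j = nth Leaf (spine (phi (w2 i))) j
    & forall j, j < n -> nth Leaf (spine (mu i)) j = nth Leaf (spine (w2 i)) j ->
        nth Leaf (spine (mu i)) j = nth Leaf (spine (phi (w2 i))) j].
Proof.
pose vals a j := [seq nth Leaf (spine (mu i)) j | i <- enum 'I_m & w2 i == a].
pose cell a j := if nth Leaf (spine a) j \in vals a j then nth Leaf (spine a) j
                 else head Leaf (vals a j).
exists (fun a => lst (mkseq (cell a) n)) => i; rewrite lstK size_mkseq.
have mem_vals j : nth Leaf (spine (mu i)) j \in vals (w2 i) j.
  by apply/mapP; exists i => //; rewrite mem_filter mem_enum eqxx.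
split=> // j jn; rewrite nth_mkseq //.
  have : cell (w2 i) j \in vals (w2 i) j.
    rewrite /cell; case: ifP => // _; have := mem_vals j.
    by case: (vals _ _) => //= x s _; exact: mem_head.
  by case/mapP => i'; rewrite mem_filter => /andP[/eqP wi' _] ->; exists i'.
by move=> e'; rewrite /cell -e' mem_vals.
Qed.

(** There are at most [K] moves. Each holds an index below [K * (K + L)] and at most [K] copy
    orders, each with an index below [K + L] and at most [K] bits. Unary indices and list lengths
    contribute additively to the height, and the square absorbs their sum. *)
Lemma attempt_complete : exists2 adv,
  height adv <= (K + L + 4) * (K + L + 4) & accepts K L (attempt R adv).
Proof.
have [phi hphi] := normalized; pose w3 := phi \o w2.
have w3_size i : size (spine (w3 i)) = n by case: (hphi i).
have w3_keep i j : j < n -> nth Leaf (spine (mu i)) j = nth Leaf (spine (w2 i)) j ->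
    nth Leaf (spine (mu i)) j = nth Leaf (spine (w3 i)) j.
  by case: (hphi i) => _ _; apply.
have cost2 : cost w2 <= cost w1.
  apply: leq_sum => i _; rewrite /w2; case: ifP => // _.
  rewrite (hammingE (mu_size i) (mu_size i)) big1 // => j _.
  by rewrite eqxx.
have cost3 : cost w3 <= K.
  apply: leq_trans (leq_trans cost2 w1_cost); apply: leq_sum => i _.
  by apply: (hamming_le (mu_size i) (w2_size i)) => //; exact: w3_keep.
have fair3 : fair_map col w3.
  apply: fair_map_comp; apply/fair_rowsE; rewrite (fair_rows_perm w2_perm).
  exact/fair_rowsE.
have types3 : size (row_types (rows col w3)) <= L.
  apply: leq_trans w1_types; rewrite -(size_row_types_perm w2_perm) !row_typesE.
  by have := size_undup_map phi [seq w2 i | i <- enum 'I_m]; rewrite -map_comp.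
(* The distances of two different rows to their targets are separate summands of the cost, so
   together they stay within [K]. *)
have ham2 i i' : i != i' ->
    hamming (spine (mu i)) (spine (w3 i)) + hamming (spine (mu i')) (spine (w3 i')) <= K.
  move=> ne; apply: leq_trans cost3; rewrite /cost (bigD1 i) //= (bigD1 i') 1?eq_sym //=.
  by rewrite addnA leq_addr.
(* A frozen row equals its input row in [w2], and normalization keeps every cell that agrees with
   the input. *)
have unfrozen i : w3 i != mu i -> ~~ frozen (col i).
  apply: contra => fi; rewrite -[w3 i]spineK -[mu i]spineK; apply/eqP; congr lst.
  apply: (@eq_from_nth _ Leaf); rewrite w3_size ?mu_size // => j jn.
  by rewrite -w3_keep // /w2 fi.
have descP i : exists desc, [/\ dest types (mu i) desc = w3 i
    & w3 i != mu i -> height desc <= K + (K + size types + 3)].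
  have hi : hamming (spine (mu i)) (spine (w3 i)) <= K.
    by apply: leq_trans cost3; rewrite /cost (bigD1 i) //= leq_addr.
  (* The cells of row [i] to be changed. One source row is chosen for each of them, so at most [K]
     merges are made. *)
  pose D := [seq j <- iota 0 n | nth Leaf (spine (mu i)) j != nth Leaf (spine (w3 i)) j].
  have sD : size D <= K.
    apply: leq_trans hi; rewrite (hammingE (mu_size i) (w3_size i)) size_filter.
    by rewrite -sumn_count sumnE big_map -[n in iota 0 n]subn0 big_mkord.
  have mem_D j : j < n -> nth Leaf (spine (mu i)) j != nth Leaf (spine (w3 i)) j -> j \in D.
    by move=> jn ne; rewrite mem_filter ne mem_iota.
  have [|ts [sts h1 h2]] := @seq_witnesses _ _ (fun j t => exists2 i', t = mu i' &
      w2 i' = w2 i /\ nth Leaf (spine t) j = nth Leaf (spine (w3 i)) j) D.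
    move=> j; rewrite mem_filter mem_iota => /andP[_ /andP[_ jn]].
    by have [_ /(_ j jn) [i' e1 e2] _] := hphi i; exists (mu i'), i'.
  have [||ds [sds eds hds]] := @merges_reach (mu i) (w3 i) (w3_size i) ts (mu i) (mu_size i).
  - move=> t /h1[j jD [i' -> [wi' tj]]]; split; [exact: mem_types | exact: mu_size |].
    have w3i : w3 i' = w3 i by rewrite /w3 /= wi'.
    rewrite -[in X in _ + X]w3i ham2 //.
    (* The source row cannot be row [i] itself, which misses the target value in column [j]. *)
    by apply: contraTneq jD => ii'; rewrite mem_filter {1}ii' tj eqxx.
  - move=> j jn; have [->|] := eqVneq (nth Leaf (spine (mu i)) j) (nth Leaf (spine (w3 i)) j).
      by left.
    case/(mem_D j jn)/h2 => t tts [i' _ [_ tj]].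
    by right; exists t.
  exists (lst ds); split; first by rewrite /dest lstK.
  move=> _; apply: leq_trans (height_lst _ hds) _; first by rewrite addnS.
  by rewrite leq_add2r sds sts.
have [desc hdesc] := fin_all_exists descP.
pose key i := Node (col i) (mu i).
pose mv := [seq Node (unary (index (key i) (editable R e))) (desc i) | i <- edited w3].
pose adv := Node (unary e) (lst mv); exists adv.
  have hmv : {in mv, forall x, height x <= K * (K + L) + (K + (K + (K + L) + 3)) + 2}.
    move=> x /mapP[i]; rewrite mem_edited => wi -> /=.
    have := size_types; have := size_editable.
    have : index (key i) (editable R e) < size (editable R e).
      by rewrite index_mem; apply/mem_editable/unfrozen.
    have := height_unary (index (key i) (editable R e)).
    have [_ /(_ wi)] := hdesc i.
    set q := K * (K + L); lia.
  have smv : size mv <= K.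
    by rewrite size_map; apply: leq_trans (size_edited w3_size) cost3.
  have := height_lst _ hmv; have := height_unary e; have := ref_index_le.
  rewrite /adv /= => h1 h2 h3; have {}h3 := h3 (ltn_addl _ (ltn0Sn 1)).
  have -> : (K + L + 4) * (K + L + 4) = K * (K + L) + L * (K + L) + 8 * (K + L) + 16 by lia.
  by move: h3; set q := K * (K + L); lia.
(* The moves may land on other copies of the intended rows, so the two lists of changes agree only
   up to order; acceptance does not depend on it. *)
have -> : accepts K L (attempt R adv) = accepts K L (changes w3).
  apply: accepts_perm.
  pose mv' := [seq Node (key i) (Node (col i) (w3 i)) | i <- edited w3].
  pose U := [seq key i | i <- enum 'I_m & ~~ (w3 i != mu i)].
  have -> : attempt R adv = apply_moves R mv'.
    rewrite /attempt /= size_spine_unary lstK -map_comp; congr apply_moves.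
    apply/eq_in_map => i; rewrite mem_edited => /unfrozen/mem_editable ed.
    rewrite /= /move_of /= size_spine_unary nth_index //=.
    by have [-> _] := hdesc i.
  apply: (@perm_trans _ (mv' ++ [seq Node a a | a <- U])).
    apply: apply_moves_perm.
    - by move=> a /mapP[i _ ->].
    - by move=> a /mapP[i _ ->].
    - by rewrite -map_comp -map_cat; apply: perm_map; rewrite perm_filterC.
  have -> : [seq Node a a | a <- U] = [seq Node (key i) (Node (col i) (w3 i))
      | i <- enum 'I_m & ~~ (w3 i != mu i)].
    rewrite -map_comp; apply/eq_in_map => i; rewrite mem_filter negbK => /andP[/eqP wi _].
    by rewrite /= wi.
  by rewrite -map_cat; apply: perm_map; rewrite perm_filterC.
rewrite /accepts changes_snd edits_changes cost3 types3 !andbT.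
exact/fair_rowsE.
Qed.

End Solution.

End Completeness.

(** * Matrices and the search *)

Section Matrices.
Variables (m n d c : nat) (g : {ffun 'I_m -> 'I_c}).

Definition row_tree (v : 'rV['I_d]_n) : tree := lst [seq enc_nat (v ord0 j) | j <- enum 'I_n].
Definition mx_row (A : 'M['I_d]_(m, n)) (i : 'I_m) : tree := row_tree (row i A).
Definition color_tree (i : 'I_m) : tree := enc_nat (g i).

Lemma size_row_tree v : size (spine (row_tree v)) = n.
Proof. by rewrite lstK size_map size_enum_ord. Qed.

Lemma nth_row_tree v (j : 'I_n) : nth Leaf (spine (row_tree v)) j = enc_nat (v ord0 j).
Proof. by rewrite lstK (nth_map j) ?nth_ord_enum // size_enum_ord. Qed.

Lemma row_tree_inj : injective row_tree.
Proof.
move=> u v uv; apply/rowP => j; apply/val_inj/enc_nat_inj.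
by have := nth_row_tree u j; rewrite uv nth_row_tree.
Qed.

Lemma enc_mxE A : enc_mx A = lst [seq mx_row A i | i <- enum 'I_m].
Proof.
rewrite /enc_mx enc_seqE; congr lst; apply: eq_map => i.
by rewrite enc_seqE /mx_row /row_tree; congr lst; apply: eq_map => j; rewrite mxE.
Qed.

Lemma sum_bool_card (T : finType) (p : pred T) : \sum_i (p i : nat) = #|[set i | p i]|.
Proof.
by rewrite -sum1_card [RHS]big_mkcond; apply: eq_bigr => i _; rewrite inE; case: (p i).
Qed.

Lemma hamming_row_tree u v :
  hamming (spine (row_tree u)) (spine (row_tree v)) = #|[set j | u ord0 j != v ord0 j]|.
Proof.
rewrite (hammingE (size_row_tree u) (size_row_tree v)) -sum_bool_card.
apply: eq_bigr => j _; rewrite !nth_row_tree; congr (nat_of_bool (~~ _)).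
by apply/eqP/eqP => [/enc_nat_inj/val_inj|->].
Qed.

Lemma num_editsE M A : num_edits M A = cost (mx_row M) (mx_row A).
Proof.
rewrite /num_edits -sum_bool_card /cost.
rewrite -(pair_bigA _ (fun i j => (M i j != A i j : nat))) /=; apply: eq_bigr => i _.
by rewrite hamming_row_tree -sum_bool_card; apply: eq_bigr => j _; rewrite !mxE.
Qed.

Lemma num_distinct_rowsE A :
  num_distinct_rows A = size (row_types (rows color_tree (mx_row A))).
Proof.
rewrite row_typesE /num_distinct_rows.
have -> : [seq mx_row A i | i <- enum 'I_m] = map row_tree [seq row i A | i <- enum 'I_m].
  by rewrite -map_comp.
rewrite (undup_map_inj row_tree_inj) size_map -(card_uniqP (undup_uniq _)).
apply: eq_card => v; rewrite mem_undup; apply/imsetP/mapP => [[i _ ->]|[i _ ->]].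
  by exists i; rewrite ?mem_enum.
by exists i.
Qed.

Lemma cell_count_mx A i i' : cell_count color_tree (mx_row A) (color_tree i) (mx_row A i')
  = #|[set j | row j A == row i' A] :&: color_class g (g i)|.
Proof.
rewrite /cell_count sum_bool_card; apply: eq_card => j; rewrite !inE andbC.
congr andb; apply/eqP/eqP.
- exact: row_tree_inj.
- by rewrite /mx_row => ->.
- by move/enc_nat_inj/val_inj.
- by rewrite /color_tree => ->.
Qed.

Lemma color_count_mx i : color_count color_tree (color_tree i) = #|color_class g (g i)|.
Proof.
rewrite /color_count sum_bool_card; apply: eq_card => j; rewrite !inE.
by apply/eqP/eqP => [/enc_nat_inj/val_inj|]; rewrite // /color_tree => ->.
Qed.

Lemma row_count_mx A i : row_count (mx_row A) (mx_row A i) = #|[set j | row j A == row i A]|.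
Proof.
rewrite /row_count sum_bool_card; apply: eq_card => j; rewrite !inE.
by apply/eqP/eqP => [/row_tree_inj|]; rewrite // /mx_row => ->.
Qed.

Lemma cluster_class (A : 'M['I_d]_(m, n)) i : cluster A [set j | row j A == row i A].
Proof.
apply/maxsetP; split.
  apply/forall_inP => j; rewrite inE => /eqP ji; apply/forall_inP => j'.
  by rewrite inE ji eq_sym.
move=> S /forall_inP hS sub; apply/eqP; rewrite eqEsubset sub andbT.
apply/subsetP => j jS; rewrite inE.
have iS : i \in S by apply: (subsetP sub); rewrite inE.
by have /forall_inP := hS j jS; apply.
Qed.

(** Nonempty clusters are the classes of equal rows, and the rational identity is cleared of its
    denominator since [m] is positive as soon as a row exists. The empty cluster and colors without
    rows have no representative row and are settled separately. *)
Lemma fairP A : fair g A <-> fair_rows (rows color_tree (mx_row A)).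
Proof.
have natE (x y z : nat) : 0 < m -> (x%:R = y%:R / m%:R * z%:R :> rat)%R <-> x * m = y * z.
  move=> m0; have mn0 : (m%:R != 0 :> rat)%R by rewrite Num.Theory.pnatr_eq0 -lt0n.
  rewrite -GRing.mulrA [(_^-1 * _)%R]GRing.mulrC GRing.mulrA -GRing.natrM.
  split=> [h|h]; last by rewrite -h GRing.natrM GRing.mulfK.
  apply/eqP; rewrite -(Num.Theory.eqr_nat rat) GRing.natrM h.
  by rewrite GRing.mulfVK.
rewrite fair_rowsE; split=> [fA|fA S k clS].
  suff pw i i' : cell_count color_tree (mx_row A) (color_tree i) (mx_row A i') * m
     = color_count color_tree (color_tree i) * row_count (mx_row A) (mx_row A i').
    apply/fair_rowsE/allP => _ /mapP[i _ ->]; apply/allP => _ /mapP[i' _ ->].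
    by rewrite !(count_rows, count_rows_fst, count_rows_snd) /= size_map size_enum_ord pw.
  have m0 : 0 < m by apply: leq_ltn_trans (ltn_ord i).
  rewrite cell_count_mx color_count_mx row_count_mx.
  exact/natE/fA/cluster_class.
have [->|[i iS]] := set_0Vmem S; first by rewrite set0I cards0 GRing.mulr0.
have SE : S = [set j | row j A == row i A].
  case/maxsetP: clS => /forall_inP hS maxS; apply/esym/maxS.
    by have /maxsetP[] := cluster_class A i.
  by apply/subsetP => j jS; rewrite inE; have /forall_inP := hS j jS; apply.
have m0 : 0 < m by apply: leq_ltn_trans (ltn_ord i).
have [k0|[j]] := set_0Vmem (color_class g k).
  by rewrite k0 setI0 cards0 !GRing.mul0r.
rewrite inE => /eqP <-; apply/natE => //.
by rewrite SE -cell_count_mx -color_count_mx -row_count_mx fA.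
Qed.

(** Invariant for soundness: cells are only ever copied within a column, so every row produced has
    length [n] and entries in the domain. *)
Definition is_row (t : tree) : Prop := exists v : 'rV['I_d]_n, t = row_tree v.

Lemma merge_rows_is_row bits w t : is_row w -> is_row t -> is_row (merge_rows bits w t).
Proof.
move=> [u ->] [v ->]; rewrite merge_rowsE.
set s := merge _ _ _.
have suv : size (spine (row_tree u)) = size (spine (row_tree v)) by rewrite !size_row_tree.
exists (\row_j if nth Leaf s j == enc_nat (u ord0 j) then u ord0 j else v ord0 j)%R.
congr lst; apply: (@eq_from_nth _ Leaf).
  by rewrite size_merge // size_row_tree size_map size_enum_ord.
rewrite size_merge // size_row_tree => j jn; pose j' := Ordinal jn.
rewrite (nth_map j') ?size_enum_ord // -[j]/(j' : nat) nth_ord_enum mxE.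
case: eqP => // ne; have [e|->] := nth_merge bits j' suv; last exact: nth_row_tree.
by case: ne; rewrite -nth_row_tree.
Qed.

Lemma dest_is_row types u desc :
  {in types, forall t, is_row t} -> is_row u -> is_row (dest types u desc).
Proof.
move=> ht hu; rewrite /dest; elim: (spine desc) {-2}u (hu) => //= x s IH w hw.
apply: IH; apply: merge_rows_is_row => //.
have [lt|ge] := ltnP (size (spine (tfst x))) (size types); last by rewrite nth_default.
by apply: ht; rewrite mem_nth.
Qed.

(** This holds for every tree [adv]: a source index out of range gives a move that starts at no row,
    an index of a row type out of range falls back to the source row, and missing bits copy
    nothing. *)
Lemma attempt_rows (M : 'M['I_d]_(m, n)) adv : exists A : 'M['I_d]_(m, n),
  attempt (rows color_tree (mx_row M)) adv = changes color_tree (mx_row M) (mx_row A).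
Proof.
set R := rows _ _; pose r i := Node (color_tree i) (mx_row M i).
rewrite /attempt; set mv := map _ _.
have [|b [-> hb]] := @apply_moves_pointwise _ r (enum 'I_m) mv (enum_uniq _); first by [].
have bP i : exists v : 'rV['I_d]_n, b i = Node (color_tree i) (row_tree v).
  have [->|] := hb i (mem_enum _ i); first by exists (row i M).
  move/mapP => [x _]; rewrite /move_of => -[er ->]; rewrite -er /r /=.
  have [||v ->] := @dest_is_row (row_types R) (mx_row M i) (tsnd x); last by exists v.
    by move=> t; rewrite /R row_typesE mem_undup => /mapP[i' _ ->]; exists (row i' M).
  by exists (row i M).
have [v hv] := fin_all_exists bP.
exists (\matrix_(i, j) v i ord0 j)%R; apply: eq_map => i; rewrite hv /mx_row.
congr (Node _ (Node _ (row_tree _))); apply/rowP => j.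
by rewrite !mxE.
Qed.

Lemma verify_sound (M : 'M['I_d]_(m, n)) K L adv :
  verify (rows color_tree (mx_row M)) K L adv != Leaf ->
  exists A : 'M['I_d]_(m, n),
    [/\ verify (rows color_tree (mx_row M)) K L adv = Node (enc_mx A) Leaf,
        fair g A, num_edits M A <= K & num_distinct_rows A <= L].
Proof.
have [A eA] := attempt_rows M adv; rewrite /verify; case: ifP => // acc _; exists A.
move: acc; rewrite /answer eA /accepts changes_snd edits_changes => /and3P[/fairP fA eK tL].
split; rewrite ?num_editsE ?num_distinct_rowsE // enc_mxE -!map_comp.
by congr (Node (lst _) _); apply: eq_map.
Qed.

Lemma verify_complete (M A : 'M['I_d]_(m, n)) K L :
  fair g A -> num_edits M A <= K -> num_distinct_rows A <= L ->
  exists2 adv, height adv <= (K + L + 4) * (K + L + 4)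
    & verify (rows color_tree (mx_row M)) K L adv != Leaf.
Proof.
move=> /fairP/fair_rowsE fA; rewrite num_editsE num_distinct_rowsE => eK tL.
have sM i : size (spine (mx_row M i)) = n by exact: size_row_tree.
have sA i : size (spine (mx_row A i)) = n by exact: size_row_tree.
have [adv hadv acc] := attempt_complete sM sA fA eK tL.
by exists adv => //; rewrite /verify acc.
Qed.

End Matrices.

(** * The search over all advices and its running time *)

Definition input_rows (x : tree) : seq tree :=
  tzip (spine (tfst (tsnd (tsnd (tsnd (tsnd (tsnd x)))))))
       (spine (tfst (tsnd (tsnd (tsnd (tsnd x)))))).

Definition budgets (x : tree) : tree :=
  Node (tfst (tsnd (tsnd (tsnd (tsnd (tsnd (tsnd x)))))))
       (tfst (tsnd (tsnd (tsnd (tsnd (tsnd (tsnd (tsnd x)))))))).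

(** The unary budgets are returned with the list because [verify] needs them and the conversion from
    binary is not polynomial. The height is that of [attempt_complete]. *)
Definition advice (v : tree) : tree :=
  let K := unary_of_bits (tfst v) in
  let L := unary_of_bits (tsnd v) in
  let s := size (spine K) + size (spine L) + 4 in
  Node (Node K L) (trees (nseq (s * s) Leaf)).

Definition search (v : tree) : tree :=
  foldl (fun res adv =>
           if res == Leaf then
             verify (input_rows (tfst v)) (size (spine (tfst (tfst (tsnd v)))))
                    (size (spine (tsnd (tfst (tsnd v))))) adv
           else res)
        Leaf (spine (tsnd (tsnd v))).

Lemma feasible_budgets : feasible poly_family budgets.
Proof. by rewrite /budgets; feasible_tac. Qed.

Lemma feasible_advice : feasible elem_family advice.
Proof.
have hK : feasible elem_family (fun v => unary_of_bits (tfst v)).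
  by apply: feasible_unary_of_bits; feasible_tac.
have hL : feasible elem_family (fun v => unary_of_bits (tsnd v)).
  by apply: feasible_unary_of_bits; feasible_tac.
have hs : feasible_nat elem_family (fun v => size (spine (unary_of_bits (tfst v)))
    + size (spine (unary_of_bits (tsnd v))) + 4).
  by feasible_tac; exact: feasible_const.
rewrite /advice; apply: feasible_node; first exact: feasible_node.
by apply: feasible_trees; feasible_tac.
Qed.

Lemma feasible_search : feasible poly_family search.
Proof.
pose V v adv := verify (input_rows (tfst v)) (size (spine (tfst (tfst (tsnd v)))))
                    (size (spine (tsnd (tfst (tsnd v))))) adv.
have hV : feasible poly_family (fun p => V (tfst p) (tsnd p)).
  by apply: feasible_verify; rewrite /input_rows; feasible_tac.
apply: (feasible_fold (step := fun v res adv => if res == Leaf then V v adv else res)).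
- apply: feasible_if; feasible_tac.
  by apply: (@feasible_app2 _ V) => //; feasible_tac.
- exact: feasible_leaf.
- by feasible_tac.
have [a ha] := feasible_size2 hV; exists a => c x y.
by case: ifP => _; [apply: leq_trans (ha c y) (leq_addl _ _) | apply: leq_addr].
Qed.

Lemma search_first (V : tree -> tree) (s : seq tree) :
  let res := foldl (fun res adv => if res == Leaf then V adv else res) Leaf s in
  (res = Leaf -> {in s, forall adv, V adv = Leaf}) /\
  (res <> Leaf -> exists adv, res = V adv).
Proof.
elim/last_ind: s => [|s x [IH1 IH2]]; first by split.
rewrite /= foldl_rcons; set res := foldl _ _ _ in IH1 IH2 *.
case: eqP => [r0|/[dup] r0 /IH2 [adv hadv]].
  split=> [vx adv|_]; last by exists x.
  by rewrite mem_rcons in_cons => /orP[/eqP->//|]; exact: IH1.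
by split=> // _; exists adv.
Qed.

(* The advice is computed from the budgets alone, so that its time and size are
   bounded by an elementary function of the parameter; the rest is polynomial in
   the instance and the advice together. *)
Lemma compose_fpt (pre post : tree -> tree) (mid : tree -> tree) :
  feasible poly_family pre -> feasible elem_family mid -> feasible poly_family post ->
  exists P F a, [/\ 0 < size P, bounded elem_family F &
    forall v, exists2 t, runs P v (post (Node v (mid (pre v)))) t
      & t <= F (tree_size (pre v)) * tree_size v ^ a].
Proof.
move=> [P1 [T1 [a1 [c1 hT1 _]]]] [P2 [T2 [a2 [c2 hT2 hS2]]]] [P3 [T3 [a3 [c3 hT3 _]]]].
have [Q1 d1] := computes_comp c1 c2.
have [Q2 d2] := computes_node computes_id d1.
have [Q [Q0 dQ]] := computes_comp d2 c3.
pose G s := elem_family a2 s.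
(* For an input of size [s >= 1] and a middle result of size at most [z], the polynomial bounds
   follow from [s + 2 <= 3 * s] and [s + z + 3 <= (z + 4) * s]; 20 covers the evaluation rules that
   link the programs. *)
exists Q, (fun s => 3 ^ a1 + G s + (G s + 4) ^ a3 + 20), (a1 + a3); split=> //.
  apply: bounded_add (bounded_const _ _); apply: bounded_add.
    by apply: bounded_add (bounded_bd _ _); exact: bounded_const.
  apply: bounded_exp (bounded_const _ _).
  by apply: bounded_add (bounded_const _ _); exact: bounded_bd.
move=> v; have [t et le_t] := dQ v.
exists (1 + t).+1; first by apply: EvalCall et; apply: (EvalVar _ [:: v]).
have {}hT1 := hT1 v; have {}hT2 := hT2 (pre v); have {}hS2 := hS2 (pre v).
have {}hT3 := hT3 (Node v (mid (pre v))).
have s0 := tree_size_gt0 v.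
set s := tree_size v in s0 hT1 *; set z := G (tree_size (pre v)).
have b1 : T1 v <= 3 ^ a1 * s ^ a1.
  by apply: leq_trans hT1 _; rewrite -expnMn; case: (a1) => // k; rewrite leq_exp2r //; lia.
have b3 : T3 (Node v (mid (pre v))) <= (z + 4) ^ a3 * s ^ a3.
  apply: leq_trans hT3 _; rewrite -expnMn; case: (a3) => // k; rewrite leq_exp2r //=.
  by move: hS2; rewrite -/(G _) -/z -/s; nia.
have p1 : 0 < s ^ a1 by rewrite expn_gt0 s0.
have p3 : 0 < s ^ a3 by rewrite expn_gt0 s0.
rewrite expnD; move: le_t => /=; move: hT2; rewrite -/(G _) -/z.
move: b1 b3 p1 p3; move: (s ^ a1) (s ^ a3) (3 ^ a1) ((z + 4) ^ a3) => x y q w; nia.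
Qed.

Theorem theorem3 :
  fixed_parameter_tractable (FDMC (fun x => max_edits x + max_rows x)).
Proof.
have [P [F [a [P0 [b hF] hP]]]] := compose_fpt feasible_budgets feasible_advice feasible_search.
(* The pair of encoded budgets has size at most [4 * n + 10], where [n] is the parameter. *)
have [c hc] : bounded elem_family (fun n => elem b (4 * n + 10)).
  apply: (@bounded_comp elem_family b).
  apply: bounded_add (bounded_const _ _).
  by apply: bounded_mul (bounded_id _); exact: bounded_const.
(* The bound is raised to a power of two, the form whose binary encoding has been shown
   computable. *)
exists P, (fun n => exp2 (elem c n)), a; split; first exact: computable_exp2_elem.
move=> x; have [t run le_t] := hP (enc_fdmc_instance x).
set out := search _ in run; pose M := mat x.
have budE : budgets (enc_fdmc_instance x)
  = Node (enc_nat (max_edits x)) (enc_nat (max_rows x)) by [].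
have rowE : input_rows (enc_fdmc_instance x)
  = rows (color_tree (coloring x)) (mx_row M).
  rewrite /input_rows /enc_fdmc_instance /= enc_mxE lstK /enc_ffun enc_seqE lstK.
  rewrite /tzip /rows; elim: (enum _) => //= i s ->.
  by [].
have size_bud : tree_size (budgets (enc_fdmc_instance x)) <= 4 * (max_edits x + max_rows x) + 10.
  rewrite budE /=; have := size_enc_nat (max_edits x); have := size_enc_nat (max_rows x); lia.
have le_t' : t <= exp2 (elem c (max_edits x + max_rows x)) * tree_size (enc_fdmc_instance x) ^ a.
  apply: leq_trans le_t _; rewrite leq_mul2r; apply/orP; right.
  apply: leq_trans (hF _) _; apply: leq_trans (leq_exp2 _); apply: leq_trans (hc _).
  exact: elem_homo.
pose V := verify (rows (color_tree (coloring x)) (mx_row M)) (max_edits x) (max_rows x).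
pose h := (max_edits x + max_rows x + 4) * (max_edits x + max_rows x + 4).
have outE : out = foldl (fun res adv => if res == Leaf then V adv else res) Leaf
    (spine (trees (nseq h Leaf))).
  have advE : advice (budgets (enc_fdmc_instance x))
      = Node (Node (unary (max_edits x)) (unary (max_rows x))) (trees (nseq h Leaf)).
    by rewrite budE /advice /= !unary_of_bitsE !size_spine_unary.
  by rewrite /out advE /search [tfst (Node _ _)]/= rowE /= !size_spine_unary.
have [none some] := search_first V (spine (trees (nseq h Leaf))).
rewrite -outE in none some.
have [out0|/eqP out0] := eqVneq out Leaf.
  (* [Leaf] encodes [None]. If there were a solution, some advice of height at most [h] would
     succeed, but all of these have been tried in vain. *)
  exists None, t; split=> //; first by move: run; rewrite out0.
  move=> A [fA eA rA].
  have [adv hadv /eqP []] := verify_complete fA eA rA.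
  by apply: none => //; apply: mem_trees; rewrite size_nseq.
have [adv hadv] := some out0.
have [|A [vA fA eA rA]] := @verify_sound _ _ _ _ (coloring x) M (max_edits x) (max_rows x) adv.
  by rewrite -/(V adv) -hadv; apply/eqP.
exists (Some A), t; split=> //.
by move: run; rewrite hadv /V vA.
Qed.
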